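(* Let $H=\langle n_1,n_2,n_3,n_4\rangle$ be a numerical semigroup minimally generated by $n_1<n_2<n_3<n_4$, and assume that $H$ is almost symmetric of type $3$. If $I_H$ is minimally generated by more than $6$ elements, then $I_H$ is minimally generated by $7$ elements and $n_1+n_4=n_2+n_3$.
   Context: A numerical semigroup is a submonoid $H\subset\mathbb N$ with $0\in H$ and $\mathbb N\setminus H$ finite; we assume $H\ne\mathbb N$. $\mathrm F(H)=\max(\mathbb N\setminus H)$; $\mathrm{PF}(H)=\{f\in\mathbb Z\setminus H : f+n_i\in H\text{ for all }i\}$; the type of $H$ is $|\mathrm{PF}(H)|$; $H$ is almost symmetric if $2|\mathbb N\setminus H|=\mathrm F(H)+|\mathrm{PF}(H)|$. $K$ is a field and $I_H$ is the kernel of the $K$-algebra map $K[x_1,\dots,x_4]\to K[t]$, $x_i\mapsto t^{n_i}$, homogeneous with respect to the grading $\deg x_i=n_i$. *)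

(* Defs.v *)
From HB Require Import structures.
From mathcomp Require Import all_boot all_order all_algebra.
From mathcomp Require Import finmap mpoly.
From mathcomp Require Import boolp classical_sets functions cardinality.

Set Implicit Arguments.
Unset Strict Implicit.
Unset Printing Implicit Defensive.

Import GRing.Theory.

Local Open Scope classical_set_scope.
Local Open Scope nat_scope.

Record numerical_semigroup (H : set nat) : Prop := NumericalSemigroup {
  ns_zero : H 0;
  ns_add : forall a b, H a -> H b -> H (a + b);
  ns_finite : finite_set (~` H);
  ns_proper : H <> setT }.

Definition gaps (H : set nat) : {fset nat} := fset_set (~` H).

Definition frobenius (H : set nat) : nat := \max_(g <- gaps H) g.

(* The submonoid generated by the n_i with i in A. *)
Definition submonoid_gen e (n : 'I_e -> nat) (A : {set 'I_e}) : set nat :=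
  [set h | exists a : 'I_e -> nat, h = \sum_(i in A) a i * n i].

Definition minimally_generated e (n : 'I_e -> nat) (H : set nat) : Prop :=
  submonoid_gen n [set: 'I_e]%SET = H /\
  forall A : {set 'I_e}, submonoid_gen n A = H -> A = [set: 'I_e]%SET.

(* Membership of an integer in H, for H viewed as a subset of Z. *)
Definition zmem (H : set nat) : set int := Posz @` H.

Definition pseudo_frobenius e (n : 'I_e -> nat) (H : set nat) : set int :=
  [set f | ~ zmem H f /\ forall i, zmem H (f + Posz (n i))%R].

(* fset_set is set to fset0 on infinite sets, but the pseudo-Frobenius numbers of
   a numerical semigroup are finitely many as soon as e > 0. *)
Definition ns_type e (n : 'I_e -> nat) (H : set nat) : nat :=
  #|` fset_set (pseudo_frobenius n H)|.

Definition almost_symmetric e (n : 'I_e -> nat) (H : set nat) : Prop :=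
  2 * #|` gaps H| = frobenius H + ns_type n H.

Definition wdeg e (n : 'I_e -> nat) (m : 'X_{1..e}) : nat :=
  \sum_(i < e) m i * n i.

Fact wdeg0 e (n : 'I_e -> nat) : wdeg n 0%MM = 0.
Proof. by rewrite /wdeg big1 // => i _; rewrite mnm0E. Qed.

Fact wdegD e (n : 'I_e -> nat) : {morph wdeg n : m1 m2 / (m1 + m2)%MM >-> m1 + m2}.
Proof.
move=> m1 m2; rewrite /wdeg -big_split /=.
by apply: eq_bigr => i _; rewrite mnmDE mulnDl.
Qed.

HB.instance Definition _ e (n : 'I_e -> nat) :=
  isMeasure.Build e (wdeg n) (wdeg0 n) (wdegD n).

Definition gens4 (n1 n2 n3 n4 : nat) : 'I_4 -> nat :=
  tnth [tuple n1; n2; n3; n4].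

Local Open Scope ring_scope.

(* Kernel of K[x_1,...,x_e] -> K[t], x_i |-> t^{n_i}. *)
Definition toric_ideal (K : fieldType) e (n : 'I_e -> nat) : set {mpoly K[e]} :=
  [set p | mmap (@polyC K) (fun i => 'X^(n i)) p = 0].
Arguments toric_ideal K [e] n.

Definition ideal_gen (K : fieldType) e (s : seq {mpoly K[e]}) :
    set {mpoly K[e]} :=
  [set p | exists c : 'I_(size s) -> {mpoly K[e]}, p = \sum_i c i * s`_i].

(* Homogeneous generators of I no proper subfamily of which generates I. For a
   homogeneous ideal and positive weights n_i, all such families have the same
   cardinality, the minimal number of generators of I (graded Nakayama). *)
Definition minimal_homog_generators (K : fieldType) e (n : 'I_e -> nat)
    (I : set {mpoly K[e]}) (s : seq {mpoly K[e]}) : Prop :=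
  [/\ {in s, forall p, p \is homog (wdeg n)},
      ideal_gen s = I
    & forall t, subseq t s -> ideal_gen t = I -> t = s].

(* Main.v *)
(* Let PF(H) = {f, g, F}.  Almost symmetry gives F = f + g, and for every integer x
   exactly one of x in H, F - x in H, x in {f, g} holds.

   The number of minimal generators of I_H in degree d is one less than the number of
   components of the graph on {1, .., 4} with vertices {i : d - n_i in H} and edges
   {ij : d - n_i - n_j in H}.  Call ij a label of d if d - n_i - n_j is f or g.
   Passing from d to F + n_1 + .. + n_4 - d exchanges edges with the pairs that are
   neither edges nor labels, up to taking opposite pairs in K_4.  As K_4 is self-dual
   as a matroid, the numbers of components that the labels of the two degrees merge
   add up to the number of labels of d.  There are 12 labels in all, so if the labels
   connect every such graph then I_H has 6 generators.

   The key point is that edges and labels always connect the graph of d, unless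
   d = n_1 + n_4 = n_2 + n_3, where two components may remain and give a 7th
   generator.  For an isolated vertex l this follows since some f + n_z or g + n_z is a multiple of n_l.  For two pairs
   ij and kl one looks at neighbouring corners of the staircase of those
   x n_i + y n_j that exceed n_k or n_l by an element of H: the degree of their least
   common multiple contains a triangle of edges, which makes a vertex isolated in the
   dual degree, unless f + n_t or g + n_t lies in <n_i, n_j> for some t in {k, l}.
   This leaves only row-factorization patterns that force d = n_i + n_j = n_k + n_l. *)

Require Import Defs.
From Stdlib Require Import ZArith Zwf Lia.
From mathcomp Require Import all_boot all_order all_algebra.
From mathcomp Require Import finmap mpoly.
From mathcomp Require Import boolp classical_sets functions cardinality.

Set Implicit Arguments.
Unset Strict Implicit.
Unset Printing Implicit Defensive.

Import GRing.Theory.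

(* The usual delimiter [Z] is taken over by mathcomp's [int]. *)
Delimit Scope Z_scope with ZZ.

(** * Almost symmetric semigroups of type 3 with four generators *)

Section Semigroups.
Local Open Scope Z_scope.

(* [m] is membership in an almost symmetric semigroup with minimal generators [i],
   [j], [k], [l] and pseudo-Frobenius numbers [f], [g], [f + g]. *)
Record as3 (m : Z -> Prop) (f g i j k l : Z) : Prop := AS3 {
  as0 : m 0;
  asD : forall x y, m x -> m y -> m (x + y);
  as_ge0 : forall x, m x -> 0 <= x;
  as_gens : [/\ m i, m j, m k & m l];
  as_neq : [/\ i <> j, i <> k & i <> l] /\ [/\ j <> k, j <> l & k <> l];
  as_gt0 : [/\ 0 < i, 0 < j, 0 < k & 0 < l];
  as_split : forall x, m x -> [\/ x = 0 \/ m (x - i), m (x - j), m (x - k) | m (x - l)];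
  as_mini : [/\ ~ m (i - j), ~ m (i - k) & ~ m (i - l)];
  as_minj : [/\ ~ m (j - i), ~ m (j - k) & ~ m (j - l)];
  as_mink : [/\ ~ m (k - i), ~ m (k - j) & ~ m (k - l)];
  as_minl : [/\ ~ m (l - i), ~ m (l - j) & ~ m (l - k)];
  as_fg : [/\ f <> g, ~ m f & ~ m g];
  as_pf : forall x, m x -> x <> 0 -> m (f + x);
  as_pg : forall x, m x -> x <> 0 -> m (g + x);
  as_gap : forall x, m x -> ~ m (f + g - x);
  as_dual : forall x, ~ m x -> [\/ m (f + g - x), x = f | x = g] }.

(** * Symmetries of the data and factorizations of elements *)

Lemma as3_swap m f g i j k l : as3 m f g i j k l -> as3 m f g j i k l.
Proof.
case=> a0 aD age [? ? ? ?] [[? ? ?] [? ? ?]] [? ? ? ?] asp [? ? ?] [? ? ?] [? ? ?] [? ? ?] afg pf pg gp du.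
split=> //; first by split; split=> //; lia.
by move=> x /asp; case=> [[|]|||] h; [do 2 constructor|constructor 2|do 2 constructor|constructor 3|constructor 4].
Qed.

Lemma as3_rot m f g i j k l : as3 m f g i j k l -> as3 m f g j k l i.
Proof.
case=> a0 aD age [? ? ? ?] [[? ? ?] [? ? ?]] [? ? ? ?] asp [? ? ?] [? ? ?] [? ? ?] [? ? ?] afg pf pg gp du.
split=> //; first by split; split=> //; lia.
by move=> x /asp; case=> [[|]|||] h; [do 2 constructor|constructor 4|do 2 constructor|constructor 2|constructor 3].
Qed.

Lemma as3_fg m f g i j k l : as3 m f g i j k l -> as3 m g f i j k l.
Proof.
case=> a0 aD age mm ne gt asp mi mj mk ml [? ? ?] pf pg gp du.
split=> //; first by split=> //; lia.
  by move=> x; rewrite (Z.add_comm g); apply: gp.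
by move=> x /du; rewrite (Z.add_comm g); case=> h; [constructor 1|constructor 3|constructor 2].
Qed.

Lemma as3_half m f g i j k l : as3 m f g i j k l -> as3 m f g k l i j.
Proof. by move=> /as3_rot/as3_rot. Qed.

Lemma as3_swap34 m f g i j k l : as3 m f g i j k l -> as3 m f g i j l k.
Proof. by move=> /as3_half/as3_swap/as3_half. Qed.

Lemma as3_rot3 m f g i j k l : as3 m f g i j k l -> as3 m f g j k i l.
Proof. by move=> /as3_rot/as3_swap34. Qed.

Lemma as3_mul m f g i j k l c x : as3 m f g i j k l -> 0 <= c -> m x -> m (c * x).
Proof.
move=> h; move: c; apply: natlike_ind => [|c c0 IH] mx; first by rewrite Z.mul_0_l; apply: as0 h.
have -> : Z.succ c * x = c * x + x by lia.
by apply: (asD h) => //; apply: IH.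
Qed.

Lemma as3_fact m f g i j k l x : as3 m f g i j k l -> m x ->
  exists a b c e, [/\ 0 <= a, 0 <= b, 0 <= c & 0 <= e] /\ x = a * i + b * j + c * k + e * l.
Proof.
move=> h mx; have x0 := as_ge0 h mx; move: x x0 mx.
apply: (well_founded_ind (Zwf_well_founded 0)) => x IH x0 mx.
have [i0 j0 k0 l0] := as_gt0 h.
have step y : m (x - y) -> 0 < y -> exists a b c e, [/\ 0 <= a, 0 <= b, 0 <= c & 0 <= e] /\
    x - y = a * i + b * j + c * k + e * l.
  move=> my y0; have := as_ge0 h my => ?; apply: IH => //; rewrite /Zwf; lia.
case: (as_split h mx) => [[->|my]|my|my|my].
- by exists 0, 0, 0, 0; split; [split|]; lia.
- have [//|a [b [c [e [[? ? ? ?] ?]]]]] := step _ my; exists (a + 1), b, c, e; split; [split|]; lia.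
- have [//|a [b [c [e [[? ? ? ?] ?]]]]] := step _ my; exists a, (b + 1), c, e; split; [split|]; lia.
- have [//|a [b [c [e [[? ? ? ?] ?]]]]] := step _ my; exists a, b, (c + 1), e; split; [split|]; lia.
- have [//|a [b [c [e [[? ? ? ?] ?]]]]] := step _ my; exists a, b, c, (e + 1); split; [split|]; lia.
Qed.

Lemma as3_comb m f g i j k l a b c e : as3 m f g i j k l ->
  0 <= a -> 0 <= b -> 0 <= c -> 0 <= e -> m (a * i + b * j + c * k + e * l).
Proof.
move=> h a0 b0 c0 e0; have [? ? ? ?] := as_gens h.
by do 3?[apply: (asD h)]; apply: (as3_mul h).
Qed.

Lemma as3_fact2 m f g i j k l x : as3 m f g i j k l -> m x -> ~ m (x - k) -> ~ m (x - l) ->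
  exists a b, [/\ 0 <= a, 0 <= b & x = a * i + b * j].
Proof.
move=> h mx nk nl; have [a [b [c [e [[a0 b0 c0 e0] E]]]]] := as3_fact h mx.
have [c1|c1] : c = 0 \/ 1 <= c by lia.
  have [e1|e1] : e = 0 \/ 1 <= e by lia.
    by exists a, b; split=> //; lia.
  case: nl; have -> : x - l = a * i + b * j + c * k + (e - 1) * l by lia.
  by apply: (as3_comb h); lia.
case: nk; have -> : x - k = a * i + b * j + (c - 1) * k + e * l by lia.
by apply: (as3_comb h); lia.
Qed.

Lemma as3_pure m f g i j k l x : as3 m f g i j k l -> m x ->
  ~ m (x - j) -> ~ m (x - k) -> ~ m (x - l) -> exists2 a, 0 <= a & x = a * i.
Proof.
move=> h mx nj nk nl; have [a [b [a0 b0 E]]] := as3_fact2 h mx nk nl.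
exists a => //; have [b1|b1] : b = 0 \/ 1 <= b by lia.
  lia.
case: nj; have -> : x - j = a * i + (b - 1) * j + 0 * k + 0 * l by lia.
by apply: (as3_comb h); lia.
Qed.

(* [m (f + x - y)] says that [y] can occur in a factorization of [f + x], i.e. that
   the entry (x, y) of some row-factorization matrix of [f] is positive. *)
Lemma as3_excl m f g i j k l x y : as3 m f g i j k l -> m (f + x - y) -> ~ m (g + y - x).
Proof.
move=> h mx my; apply: (as_gap h mx); have -> : f + g - (f + x - y) = g + y - x by lia.
by [].
Qed.

(** * Entries of row-factorization matrices and isolated vertices *)

Lemma as3_chain m f g i j k l a b : as3 m f g i j k l ->
  m (a * i - b * i) \/ m (b * i - a * i).
Proof.
move=> h; have [mi _ _ _] := as_gens h.
have [ab|ba] : 0 <= a - b \/ 0 <= b - a by lia.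
  by left; have := as3_mul h ab mi; rewrite Z.mul_sub_distr_r.
by right; have := as3_mul h ba mi; rewrite Z.mul_sub_distr_r.
Qed.

(** Two multiples of [i] differ by an element of H up to sign, so one of [f], [g] would be the other
    plus a nonzero element of H. *)
Lemma as3_same_row m f g i j k l x a b : as3 m f g i j k l ->
  f + x = a * i -> g + x = b * i -> False.
Proof.
move=> h Ef Eg; have [nfg nf ng] := as_fg h.
case: (as3_chain a b h); rewrite -Ef -Eg => mm.
  apply: nf; have -> : f = g + (f + x - (g + x)) by lia.
  by apply: (as_pg h) => //; lia.
apply: ng; have -> : g = f + (g + x - (f + x)) by lia.
by apply: (as_pf h) => //; lia.
Qed.

Lemma as3_same_col m f g i j k l u x y a b : as3 m f g i j k l ->
  ~ m (x - y) -> ~ m (y - x) -> u + x = a * i -> u + y = b * i -> False.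
Proof.
move=> h nxy nyx Ex Ey.
case: (as3_chain a b h); rewrite -Ex -Ey => mm.
  by apply: nxy; rewrite (_ : x - y = u + x - (u + y)); [|lia].
by apply: nyx; rewrite (_ : y - x = u + y - (u + x)); [|lia].
Qed.

Lemma as3_pfi m f g i j k l : as3 m f g i j k l ->
  [/\ m (f + i), m (f + j), m (f + k) & m (f + l)].
Proof.
move=> h; have [? ? ? ?] := as_gens h; have [? ? ? ?] := as_gt0 h.
by split; apply: (as_pf h) => //; lia.
Qed.

Lemma as3_row m f g i j k l : as3 m f g i j k l ->
  [\/ m (f + i - j), m (f + i - k) | m (f + i - l)].
Proof.
move=> h; have [mi _ _ _] := as3_pfi h; have [_ nf _] := as_fg h; have [? _ _ _] := as_gt0 h.
have [_ mj _ _] := as3_pfi h; have [nji _ _] := as_minj h.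
case: (as_split h mi) => [[E|]|?|?|?].
(* [as_split] allows [f + i = 0]; then [f + j] would be [j - i], against minimality. *)
- by case: nji; rewrite (_ : j - i = f + j); [|lia].
- by rewrite Z.add_simpl_r.
- by constructor 1.
- by constructor 2.
- by constructor 3.
Qed.

(* Here the rows [i], [j], [k] of both row-factorization matrices have, among the
   columns [i], [j], [k], the support of the cycle i -> j -> k -> i. *)
Lemma as3_cycle_contra m f g i j k l : as3 m f g i j k l ->
  ~ m (f + i - k) -> ~ m (f + j - i) -> ~ m (f + k - j) ->
  ~ m (g + i - k) -> ~ m (g + j - i) -> ~ m (g + k - j) ->
  ~ m (f + l - i).
Proof.
move=> h Aik Aji Akj Bik Bji Bkj Ali.
have hg := as3_fg h.
have [fi fj fk fl] := as3_pfi h; have [gi gj gk gl] := as3_pfi hg.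
have [_ _ nil] := as_mini h; have [_ njk njl] := as_minj h.
have [_ nkj nkl] := as_mink h; have [nli nlj nlk] := as_minl h.
(* In these names A stands for [f] and B for [g], followed by row and column. [Ali] removes [l] from
   row [i] of [g], which becomes a multiple of [j]; row [i] of [f] must then contain [l], or both
   rows would be multiples of [j]. *)
have Bil := as3_excl h Ali.
have hj := as3_rot h; have hk := as3_rot hj; have hl := as3_rot hk.
have [b b0 Eb] : exists2 b, 0 <= b & g + i = b * j.
  by apply: (as3_pure hj) => //; rewrite Z.add_simpl_r; case: (as_fg h).
have Ail : m (f + i - l).
  apply: contrapT => Ail; have [a a0 Ea] : exists2 a, 0 <= a & f + i = a * j.
    by apply: (as3_pure hj) => //; rewrite Z.add_simpl_r; case: (as_fg h).
  exact: as3_same_row hj Ea Eb.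
have Bli := as3_excl h Ail.
have pure_k u : m (u + j) -> ~ m u -> ~ m (u + j - i) -> ~ m (u + j - l) -> exists2 c, 0 <= c & u + j = c * k.
  by move=> *; apply: (as3_pure hk) => //; rewrite Z.add_simpl_r.
have pure_i u : m (u + k) -> ~ m u -> ~ m (u + k - j) -> ~ m (u + k - l) -> exists2 c, 0 <= c & u + k = c * i.
  by move=> *; apply: (as3_pure h) => //; rewrite Z.add_simpl_r.
have [_ nf ng] := as_fg h.
have rowA : ~ m (f + l - j) -> ~ m (f + l - k) -> exists2 c, 0 <= c & f + l = c * i.
  by move=> *; apply: (as3_pure h) => //; rewrite Z.add_simpl_r.
have rowBj : ~ m (g + l - k) -> exists2 c, 0 <= c & g + l = c * j.
  by move=> *; apply: (as3_pure hj) => //; rewrite Z.add_simpl_r.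
have rowBk : ~ m (g + l - j) -> exists2 c, 0 <= c & g + l = c * k.
  by move=> *; apply: (as3_pure hk) => //; rewrite Z.add_simpl_r.
(* Here rows [k] and [l] of [f] both become multiples of [i], which [as3_same_col] forbids. *)
have finA : ~ m (f + l - j) -> ~ m (f + k - l) -> False.
  move=> nAlj nAkl; have [c c0 Ec] := pure_i _ fk nf Akj nAkl.
  have Bkl : m (g + k - l).
    apply: contrapT => nBkl; have [c' _ Ec'] := pure_i _ gk ng Bkj nBkl.
    exact: as3_same_row h Ec Ec'.
  have [c' _ Ec'] := rowA nAlj (as3_excl hg Bkl).
  exact: as3_same_col h nkl nlk Ec Ec'.
case: (EM (m (g + l - j))) => [Blj | nBlj].
  have nAjl := as3_excl hg Blj.
  have [c c0 Ec] := pure_k _ fj nf Aji nAjl.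
  have Bjl : m (g + j - l).
    apply: contrapT => nBjl; have [c' _ Ec'] := pure_k _ gj ng Bji nBjl.
    exact: as3_same_row hk Ec Ec'.
  case: (EM (m (f + k - l))) => [Akl | nAkl].
    have [c' _ Ec'] := rowBj (as3_excl h Akl).
    exact: as3_same_col hj nli nil Ec' Eb.
  exact: finA (as3_excl hg Bjl) nAkl.
have [c c0 Ec] := rowBk nBlj.
have nAkl : ~ m (f + k - l).
  by case: (as3_row (as3_rot (as3_rot (as3_rot hg)))) => // Blk; apply: (as3_excl hg).
apply: finA nAkl => Alj.
have [c' _ Ec'] := pure_k _ gj ng Bji (as3_excl h Alj).
exact: as3_same_col hk njl nlj Ec' Ec.
Qed.

(** Exclusion and nonempty rows alternate: [Aij] kills [Bji], so row [j] of [g] needs [Bjk], which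
    kills [Akj], and so on, until both matrices show exactly the cycle i -> j -> k -> i. Row [l] of
    [f] is then positive in one of the columns [i], [j], [k], against [as3_cycle_contra]. *)
Lemma as3_cycle_false m f g i j k l : as3 m f g i j k l ->
  (m (f + i - j) \/ m (f + i - k)) -> (m (f + j - i) \/ m (f + j - k)) ->
  (m (f + k - i) \/ m (f + k - j)) ->
  (m (g + i - j) \/ m (g + i - k)) -> (m (g + j - i) \/ m (g + j - k)) ->
  (m (g + k - i) \/ m (g + k - j)) -> ~ m (f + i - j).
Proof.
move=> h fi fj fk gi gj gk Aij.
have hg := as3_fg h.
have Bji := as3_excl h Aij.
have {gj} Bjk : m (g + j - k) by case: gj.
have Akj := as3_excl hg Bjk.
have {fk} Aki : m (f + k - i) by case: fk.
have Bik := as3_excl h Aki.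
have {gi} Bij : m (g + i - j) by case: gi.
have Aji := as3_excl hg Bij.
have {fj} Ajk : m (f + j - k) by case: fj.
have Bkj := as3_excl h Ajk.
have {gk} Bki : m (g + k - i) by case: gk.
have Aik := as3_excl hg Bki.
have hr := as3_rot3 h.
case: (as3_row (as3_rot (as3_rot (as3_rot h)))).
- exact: (as3_cycle_contra h).
- exact: (as3_cycle_contra hr).
- exact: (as3_cycle_contra (as3_rot3 hr)).
Qed.

(** Otherwise each of the rows [i], [j], [k] of both matrices has a positive entry in another of
    these columns. Row [i] of [f] selects one of the two orientations of a 3-cycle, and
    [as3_cycle_false] rules out both. *)
Lemma as3_column m f g i j k l : as3 m f g i j k l ->
  exists u z c, [/\ u = f \/ u = g, [\/ z = i, z = j | z = k], 0 <= c & u + z = c * l] /\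
    [/\ ~ m (u + z - i), ~ m (u + z - j) & ~ m (u + z - k)].
Proof.
move=> h; apply: contrapT => none.
have [_ nf ng] := as_fg h; have [fi fj fk _] := as3_pfi h.
have [gi gj gk _] := as3_pfi (as3_fg h).
have row u z : u = f \/ u = g -> [\/ z = i, z = j | z = k] -> m (u + z) ->
    [\/ m (u + z - i), m (u + z - j) | m (u + z - k)].
  move=> hu hz muz; apply: contrapT => no; apply: none.
  have ni : ~ m (u + z - i) by move=> ?; apply: no; constructor 1.
  have nj : ~ m (u + z - j) by move=> ?; apply: no; constructor 2.
  have nk : ~ m (u + z - k) by move=> ?; apply: no; constructor 3.
  have [c c0 E] := as3_pure (as3_rot (as3_rot (as3_rot h))) muz ni nj nk.
  by exists u, z, c.
have rfi : m (f + i - j) \/ m (f + i - k).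
  by case: (row f i _ _ fi); [left|constructor 1|rewrite Z.add_simpl_r|left|right].
have rfj : m (f + j - i) \/ m (f + j - k).
  by case: (row f j _ _ fj); [left|constructor 2|left|rewrite Z.add_simpl_r|right].
have rfk : m (f + k - i) \/ m (f + k - j).
  by case: (row f k _ _ fk); [left|constructor 3|left|right|rewrite Z.add_simpl_r].
have rgi : m (g + i - j) \/ m (g + i - k).
  by case: (row g i _ _ gi); [right|constructor 1|rewrite Z.add_simpl_r|left|right].
have rgj : m (g + j - i) \/ m (g + j - k).
  by case: (row g j _ _ gj); [right|constructor 2|left|rewrite Z.add_simpl_r|right].
have rgk : m (g + k - i) \/ m (g + k - j).
  by case: (row g k _ _ gk); [right|constructor 3|left|right|rewrite Z.add_simpl_r].
case: (rfi) => [A|A].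
  exact: (as3_cycle_false h) A.
have h' := as3_rot3 (as3_swap h).
exact: (as3_cycle_false h' (proj1 (or_comm _ _) rfi) rfk rfj (proj1 (or_comm _ _) rgi) rgk rgj) A.
Qed.

(** None of the three pairs at [l] is an edge, so [d - l] is a multiple of [l]. It is compared with
    the multiple of [l] given by [as3_column]. *)
Lemma as3_isolated m f g i j k l d : as3 m f g i j k l ->
  m (d - l) -> m (f + g + i + l - d) -> m (f + g + j + l - d) -> m (f + g + k + l - d) ->
  ~ m (d - i).
Proof.
move=> h mdl Di Dj Dk mdi.
have nD z : m (f + g + z + l - d) -> ~ m (d - l - z).
  by move=> hz hn; apply: (as_gap h hn); rewrite (_ : _ - _ = f + g + z + l - d); [|lia].
have [c c0 Ec] := as3_pure (as3_rot (as3_rot (as3_rot h))) mdl (nD _ Di) (nD _ Dj) (nD _ Dk).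
have [_ _ _ ml] := as_gens h; have [_ nf ng] := as_fg h.
have [u [z [e [[hu hz e0 Ee] [ni nj nk]]]]] := as3_column h.
have mD : m (f + g + z + l - d) by case: hz => ->.
(* If [e <= c], adding [(c - e) * l] to the dual of the pair [z], [l] gives the gap [f + g - u].
   Otherwise [u + z - i] is [d - i] plus a multiple of [l], although [i] does not occur in
   [u + z]. *)
have [ec|ce] : e <= c \/ c + 1 <= e by lia.
  have := asD h mD (as3_mul h (_ : 0 <= c - e) ml); rewrite Z.mul_sub_distr_r -Ee -Ec.
  have -> : f + g + z + l - d + (d - l - (u + z)) = f + g - u by lia.
  by case: hu => ->; [rewrite Z.add_simpl_l => /(_ ltac:(lia))|rewrite Z.add_simpl_r => /(_ ltac:(lia))].
apply: ni; rewrite Ee (_ : _ - _ = (d - i) + (e - c - 1) * l); last by lia.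
by apply: (asD h) => //; apply: (as3_mul h) => //; lia.
Qed.

(** * Splittings into two pairs of vertices *)

Lemma Z_least (P : Z -> Prop) x0 : 0 <= x0 -> P x0 ->
  exists x, [/\ 0 <= x, P x & forall y, 0 <= y < x -> ~ P y].
Proof.
move: x0; apply: (well_founded_ind (Zwf_well_founded 0)) => x IH x0 Px.
case: (EM (exists2 y, 0 <= y < x & P y)) => [[y [y0 yx] Py]|no].
  by apply: IH Py => //; rewrite /Zwf; lia.
by exists x; split=> // y yx Py; apply: no; exists y.
Qed.

(* Adjacent corners of the staircase [{(x, y) | x i + y j - k or x i + y j - l
   lies in H}] are joined by an edge-triangle of their least common multiple,
   which [as3_isolated] forbids in the dual degree unless a pseudo-Frobenius
   number appears. *)
Lemma as3_corner m f g i j k l d a b : as3 m f g i j k l ->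
  0 <= a -> 1 <= b -> d = a * i + b * j -> m (d - k) -> m (d - l) ->
  m (f + g + i + k - d) -> m (f + g + i + l - d) ->
  m (f + g + j + k - d) -> m (f + g + j + l - d) ->
  exists u t, [/\ u = f \/ u = g, t = k \/ t = l, m (u + t - i) & m (u + j - i)] /\
    (2 <= b -> m (u + t - j)) /\ m (u + j + t - d).
Proof.
move=> h a0 b1 Ed mdk mdl Dik Dil Djk Djl.
have [mi mj mk ml] := as_gens h; have [i0 j0 k0 l0] := as_gt0 h; have [_ nf ng] := as_fg h.
have comb2 x y : 0 <= x -> 0 <= y -> m (x * i + y * j).
  by move=> x0 y0; apply: (asD h); apply: (as3_mul h).
(* The next corner is sought at height [b - 1]; it lies beyond [a] because [d - j - t] is not in H
   for [t] equal to [k] or [l]. *)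
pose P x := m (x * i + (b - 1) * j - k) \/ m (x * i + (b - 1) * j - l).
have [x [x0 Px xmin]] : exists x, [/\ 0 <= x, P x & forall y, 0 <= y < x -> ~ P y].
  apply: (@Z_least P k); first lia.
  left; rewrite (_ : _ - _ = (i - 1) * k + (b - 1) * j); last by lia.
  by apply: (asD h); apply: (as3_mul h) => //; lia.
have xa : a < x.
  suff : ~ x <= a by lia.
  move=> xa.
  have shift t : m (x * i + (b - 1) * j - t) -> ~ m (f + g + j + t - d).
    move=> mt; have := asD h mt (as3_mul h (_ : 0 <= a - x) mi) => /(_ ltac:(lia)) /(as_gap h).
    by rewrite (_ : f + g - _ = f + g + j + t - d); [|lia].
  by case: Px => /shift.
(* [v + i + j = x * i + b * j] is the degree of the least common multiple of the two corners. *)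
pose v := (x - 1) * i + (b - 1) * j.
have mv : m v by apply: comb2; lia.
have nP : ~ P (x - 1) by apply: xmin; lia.
have nvk : ~ m (v - k) by move=> ?; apply: nP; left.
have nvl : ~ m (v - l) by move=> ?; apply: nP; right.
have [u [t [hu ht Ev]]] : exists u t, [/\ u = f \/ u = g, t = k \/ t = l & u + t = v].
  case: (as_dual h nvk) => [Dk|E|E]; [|by exists f, k; split; [left|left|lia]|by exists g, k; split; [right|left|lia]].
  case: (as_dual h nvl) => [Dl|E|E]; [|by exists f, l; split; [left|right|lia]|by exists g, l; split; [right|right|lia]].
  (* In degree [v + i + j] the pairs ij, ik, jk (or ij, il, jl) are edges, so in the dual degree [D]
     the vertex [l] (or [k]) is isolated, while [k] and [l] are both vertices. *)
  pose D := f + g + k + l - v.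
  have jt t : m (d - t) -> m (v + j - t).
    move=> mt; rewrite (_ : _ - _ = (d - t) + (x - 1 - a) * i); last by rewrite /v; lia.
    by apply: (asD h) => //; apply: (as3_mul h) => //; lia.
  case: Px => Px; exfalso.
    have h' := as3_rot3 (as3_rot3 h).
    apply: (as3_isolated (d := D) h').
    - by rewrite (_ : _ - _ = f + g - (v - k)); [|rewrite /D; lia].
    - by rewrite (_ : _ - _ = v); [|rewrite /D; lia].
    - by rewrite (_ : _ - _ = x * i + (b - 1) * j - k); [|rewrite /D /v; lia].
    - by rewrite (_ : _ - _ = v + j - k); [apply: jt|rewrite /D; lia].
    - by rewrite (_ : _ - _ = f + g - (v - l)); [|rewrite /D; lia].
  have h' := as3_rot3 (as3_rot3 (as3_swap34 h)).
  apply: (as3_isolated (d := D) h').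
  - by rewrite (_ : _ - _ = f + g - (v - l)); [|rewrite /D; lia].
  - by rewrite (_ : _ - _ = v); [|rewrite /D; lia].
  - by rewrite (_ : _ - _ = x * i + (b - 1) * j - l); [|rewrite /D /v; lia].
  - by rewrite (_ : _ - _ = v + j - l); [apply: jt|rewrite /D; lia].
  - by rewrite (_ : _ - _ = f + g - (v - k)); [|rewrite /D; lia].
have mdt : m (d - t) by case: ht => ->.
have Djt : m (f + g + j + t - d) by case: ht => ->.
(* For [x - 1 = a] one gets [u + t = d - j], and the dual of the pair [j], [t] is the gap
   [f + g - u]. *)
have xa1 : a < x - 1.
  suff : a <> x - 1 by lia.
  move=> E; have Eu : f + g + j + t - d = f + g - u by rewrite /v in Ev; lia.
  move: Djt; rewrite Eu; case: hu => ->.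
    by rewrite (_ : _ - _ = g); [|lia].
  by rewrite (_ : _ - _ = f); [|lia].
exists u, t; split; [split=> //|split].
- by rewrite Ev (_ : _ - _ = (x - 2) * i + (b - 1) * j); [apply: comb2; lia|rewrite /v; lia].
- rewrite (_ : _ - _ = (d - t) + (x - 2 - a) * i); last by rewrite /v in Ev; lia.
  by apply: (asD h) => //; apply: (as3_mul h) => //; lia.
- by move=> b2; rewrite Ev (_ : _ - _ = (x - 1) * i + (b - 2) * j); [apply: comb2; lia|rewrite /v; lia].
- rewrite (_ : _ - _ = (x - 1 - a) * i); last by rewrite /v in Ev; lia.
  by apply: (as3_mul h) => //; lia.
Qed.

(** The second factorization makes kl an edge, and adding [d - k - l] to [u + j + t - d] puts the
    other vertex [t'] into row [j] of [u]. *)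
Lemma as3_corner_mixed m f g i j k l d a b c e : as3 m f g i j k l ->
  0 <= a -> 1 <= b -> 1 <= c -> 1 <= e -> d = a * i + b * j -> d = c * k + e * l ->
  m (f + g + i + k - d) -> m (f + g + i + l - d) ->
  m (f + g + j + k - d) -> m (f + g + j + l - d) ->
  exists u t t', [/\ u = f \/ u = g, t = k /\ t' = l \/ t = l /\ t' = k & m (u + t - i)] /\
    [/\ m (u + j - i), m (u + j - t') & (2 <= b -> m (u + t - j))].
Proof.
move=> h a0 b1 c1 e1 Ed Ed' Dik Dil Djk Djl; have [_ _ mk ml] := as_gens h.
have mkl x y : 0 <= x -> 0 <= y -> m (x * k + y * l).
  by move=> x0 y0; apply: (asD h); apply: (as3_mul h).
have mdk : m (d - k).
  by rewrite Ed' (_ : _ - _ = (c - 1) * k + e * l); [apply: mkl; lia|lia].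
have mdl : m (d - l).
  by rewrite Ed' (_ : _ - _ = c * k + (e - 1) * l); [apply: mkl; lia|lia].
have mdkl : m (d - k - l).
  by rewrite Ed' (_ : _ - _ = (c - 1) * k + (e - 1) * l); [apply: mkl; lia|lia].
have [u [t [[hu ht m1 m2] [m3 m4]]]] := as3_corner h a0 b1 Ed mdk mdl Dik Dil Djk Djl.
have m5 := asD h m4 mdkl.
case: ht m1 m3 m4 m5 => -> m1 m3 m4 m5.
  exists u, k, l; split; split; auto.
  by rewrite (_ : u + j - l = u + j + k - d + (d - k - l)); [|lia].
exists u, l, k; split; split; auto.
by rewrite (_ : u + j - k = u + j + l - d + (d - k - l)); [|lia].
Qed.

Ltac clash h := exfalso; match goal with
  H1 : ?m (?f + ?x - ?y), H2 : ?m (?g + ?y - ?x) |- _ => exact: as3_excl h H1 H2 end.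

Lemma as3_square_mixed1 m f g i j k l d a b c e : as3 m f g i j k l ->
  1 <= a -> 1 <= b -> 1 <= c -> 1 <= e -> d = a * i + b * j -> d = c * k + e * l ->
  m (f + g + i + k - d) -> m (f + g + i + l - d) ->
  m (f + g + j + k - d) -> m (f + g + j + l - d) -> a = 1 /\ b = 1.
Proof.
move=> h a1 b1 c1 e1 Ed Ed' Dik Dil Djk Djl.
have a0 : 0 <= a by lia. have b0 : 0 <= b by lia.
have c0 : 0 <= c by lia. have e0 : 0 <= e by lia.
have comm x y : f + g + x + y - d = f + g + y + x - d by lia.
have Eds : d = b * j + a * i by lia. have Eds' : d = e * l + c * k by lia.
(* One corner on each side of [d] on both staircases: four row patterns, each for [f] or for [g]. *)
have C1 := as3_corner_mixed h a0 b1 c1 e1 Ed Ed' Dik Dil Djk Djl.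
have C2 := as3_corner_mixed (as3_swap h) b0 a1 c1 e1 Eds Ed' Djk Djl Dik Dil.
have h2 := as3_half h.
rewrite comm in Dik; rewrite comm in Dil; rewrite comm in Djk; rewrite comm in Djl.
have C3 := as3_corner_mixed h2 c0 e1 a1 b1 Ed' Ed Dik Djk Dil Djl.
have C4 := as3_corner_mixed (as3_swap h2) e0 c1 a1 b1 Eds' Ed Dil Djl Dik Djk.
clear comm Ed Ed' Eds Eds' Dik Dil Djk Djl a0 b0 c0 e0 c1 e1 h2.
move: C1 C2 C3 C4 => [u [t1 [t1' [[hu ht1 A1] [A2 A3 A4]]]]] [u2 [t2 [t2' [[hu2 ht2 B1] [B2 B3 B4]]]]].
move=> [u3 [s3 [s3' [[hu3 hs3 C1] [C2 C3 C4]]]]] [u4 [s4 [s4' [[hu4 hs4 D1] [D2 D3 D4]]]]].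
wlog : f g h hu hu2 hu3 hu4 / u = f.
  move=> W; case: (hu) => Eu; first exact: W h hu hu2 hu3 hu4 Eu.
  by refine (W g f (as3_fg h) _ _ _ _ Eu); tauto.
move=> Eu; subst u.
have {hu2} ? : u2 = f.
  by case: hu2 => // E; subst u2; clash h.
subst u2; clear hu.
have rows := as3_row (as3_fg h).
have rowj := as3_row (as3_rot (as3_fg h)).
have rowk := as3_row (as3_half (as3_fg h)).
have rowl := as3_row (as3_rot (as3_half (as3_fg h))).
(* If [t1 = t2], the last two patterns also belong to [f], and exclusion empties row [l] or row [k]
   of [g]. Otherwise [b >= 2] would empty row [j] of [g], and [a >= 2] row [i]. *)
case: ht1 => -[? ?]; case: ht2 => -[? ?]; subst t1 t1' t2 t2'.
- have ? : u3 = f.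
    case: hu3 => // E; subst u3; case: hs3 => -[? ?]; subst s3 s3'; clash h.
  subst u3; have ? : u4 = f by case: hu4 => // E; subst u4; clash h.
  by subst u4; case: rowl => ?; clash h.
- have b_1 : ~ 2 <= b.
    by move=> /A4 A4'; case: rowj => ?; clash h.
  have a_1 : ~ 2 <= a.
    by move=> /B4 B4'; case: rows => ?; clash h.
  lia.
- have b_1 : ~ 2 <= b.
    by move=> /A4 A4'; case: rowj => ?; clash h.
  have a_1 : ~ 2 <= a.
    by move=> /B4 B4'; case: rows => ?; clash h.
  lia.
- have ? : u4 = f.
    case: hu4 => // E; subst u4; case: hs4 => -[? ?]; subst s4 s4'; clash h.
  subst u4; have ? : u3 = f by case: hu3 => // E; subst u3; clash h.
  by subst u3; case: rowk => ?; clash h.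
Qed.

(* The degenerate case in which [d] is a multiple of [i] and of [j] only, through
   [u + i] in [j N] and [u + j] in [i N]; here [u'] is the other one of [f], [g]. *)
Definition pure_pair (m : Z -> Prop) u u' i j k l d :=
  [/\ d = u + i + j, exists2 a, 0 <= a & u + j = a * i, exists2 b, 0 <= b & u + i = b * j,
      m (u + i - j) & m (u + j - i)] /\
  [/\ m (u' + k - i), m (u' + k - j), m (u' + l - i) & m (u' + l - j)].

Lemma pure_pair_swap m u u' i j k l d : pure_pair m u u' i j k l d -> pure_pair m u u' j i k l d.
Proof. by case=> -[? ? ? ? ?] [? ? ? ?]; split; split=> //; lia. Qed.

(** [as3_column] supplies [u + z = c * i], and [c < a] since [d] contains [k] or [l] but [u + z]
    does not. Only [z = j] survives; then row [i] of [u] is [b * j], so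
    [d = (a - c - 1) * i + (b + 1) * j], and [a = c + 1] is the pure pair. *)
Lemma as3_multiple m f g i j k l d a : as3 m f g i j k l ->
  d = a * i -> m (d - k) \/ m (d - l) ->
  m (f + g + i + k - d) -> m (f + g + i + l - d) ->
  m (f + g + j + k - d) -> m (f + g + j + l - d) ->
  (exists a' b, [/\ 1 <= a', 1 <= b & d = a' * i + b * j]) \/
  (exists u u', (u = f /\ u' = g \/ u = g /\ u' = f) /\ pure_pair m u u' i j k l d).
Proof.
move=> h Ed mt Dik Dil Djk Djl.
have [mi _ _ _] := as_gens h; have [_ nf ng] := as_fg h.
have [u [z [c [[hu hz c0 Ec] [nj nk nl]]]]] := as3_column (as3_rot h).
have [u' [Eu hu']] : exists u', u' = f + g - u /\ (u = f /\ u' = g \/ u = g /\ u' = f).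
  by exists (f + g - u); split=> //; case: hu => ->; [left|right]; split=> //; lia.
have nu : ~ m u by case: hu => ->.
have nu' : ~ m u' by case: hu' => -[_ ->].
have excl x y : m (u' + x - y) -> ~ m (u + y - x).
  by case: hu' => -[-> ->]; [apply: (as3_excl (as3_fg h))|apply: (as3_excl h)].
have ca : c + 1 <= a.
  suff : ~ a <= c by lia.
  move=> ac; have up t : m (d - t) -> m (u + z - t).
    move=> mdt; rewrite Ec (_ : _ - _ = (d - t) + (c - a) * i); last by lia.
    by apply: (asD h) => //; apply: (as3_mul h) => //; lia.
  by case: mt => /up.
have low x : m x -> m (x + (a - c - 1) * i).
  by move=> mx; apply: (asD h) => //; apply: (as3_mul h) => //; lia.
case: hz => Ez; subst z.
- have u'ki : m (u' + k - i) by rewrite (_ : _ - _ = f + g + j + k - d + (a - c - 1) * i); [apply: low|lia].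
  have u'li : m (u' + l - i) by rewrite (_ : _ - _ = f + g + j + l - d + (a - c - 1) * i); [apply: low|lia].
  have u'kj : m (u' + k - j) by rewrite (_ : _ - _ = f + g + i + k - d + (a - c - 1) * i); [apply: low|lia].
  have u'lj : m (u' + l - j) by rewrite (_ : _ - _ = f + g + i + l - d + (a - c - 1) * i); [apply: low|lia].
  have hs : as3 m u u' i j k l by case: hu' => -[-> ->] //; apply: as3_fg.
  have [mui muj _ _] := as3_pfi hs.
  have [b b0 Eb] : exists2 b, 0 <= b & u + i = b * j.
    apply: (as3_pure (as3_rot h)) => //; [exact: excl|exact: excl|by rewrite Z.add_simpl_r].
  have [ac|ac] : a = c + 1 \/ 1 <= a - c - 1 by lia.
    right; exists u, u'; split=> //; split; split=> //; first lia; first by exists c.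
      by exists b.
    + by case: (as3_row hs) => // /excl.
    + by case: (as3_row (as3_rot hs)) => // /excl.
  by left; exists (a - c - 1), (b + 1); split; lia.
(* For [z] equal to [k] or [l], the gap [u'] would be the dual of the pair [i], [z] plus a multiple
   of [i]. *)
- case: nu'; rewrite (_ : u' = f + g + i + k - d + (a - c - 1) * i); [exact: low|lia].
- case: nu'; rewrite (_ : u' = f + g + i + l - d + (a - c - 1) * i); [exact: low|lia].
Qed.

(** No edge joins {i, j} to {k, l}, so [d] factors through [i] and [j] alone; if only one of them
    occurs, [as3_multiple] applies. *)
Lemma as3_side m f g i j k l d : as3 m f g i j k l ->
  m (d - i) \/ m (d - j) -> m (d - k) \/ m (d - l) ->
  m (f + g + i + k - d) -> m (f + g + i + l - d) ->
  m (f + g + j + k - d) -> m (f + g + j + l - d) ->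
  (exists a b, [/\ 1 <= a, 1 <= b & d = a * i + b * j]) \/
  (exists u u', (u = f /\ u' = g \/ u = g /\ u' = f) /\ pure_pair m u u' i j k l d).
Proof.
move=> h ms mt Dik Dil Djk Djl.
have nD x y : m (f + g + x + y - d) -> ~ m (d - x - y).
  by move=> hz hn; apply: (as_gap h hn); rewrite (_ : _ - _ = f + g + x + y - d); [|lia].
have [a [b [a0 b0 Ed]]] : exists a b, [/\ 0 <= a, 0 <= b & d = a * i + b * j].
  case: ms => ms.
    have [a [b [a0 b0 E]]] := as3_fact2 h ms (nD _ _ Dik) (nD _ _ Dil).
    by exists (a + 1), b; split; lia.
  have [a [b [a0 b0 E]]] := as3_fact2 h ms (nD _ _ Djk) (nD _ _ Djl).
  by exists a, (b + 1); split; lia.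
have [b_0|b1] : b = 0 \/ 1 <= b by lia.
  by apply: (as3_multiple (a := a) h) => //; lia.
have [a_0|a1] : a = 0 \/ 1 <= a by lia.
  have [||] := as3_multiple (a := b) (as3_swap h) _ mt Djk Djl Dik Dil; first lia.
    by case=> a' [b' [? ? ?]]; left; exists b', a'; split; lia.
  by case=> u [u' [? /pure_pair_swap ?]]; right; exists u, u'.
by left; exists a, b.
Qed.

(** The pure pair forces both corners on the [k], [l] staircase to belong to [g], so [l] is absent
    from row [k] of [f]. That row is no multiple of [i] or [j], since rows [j] and [i] of [f]
    already are; hence both occur in it, against the entry (s, k) of [g]. *)
Lemma as3_pure_mixed m f g i j k l d c e : as3 m f g i j k l ->
  pure_pair m f g i j k l d -> 1 <= c -> 1 <= e -> d = c * k + e * l ->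
  m (f + g + i + k - d) -> m (f + g + i + l - d) ->
  m (f + g + j + k - d) -> m (f + g + j + l - d) -> False.
Proof.
move=> h [[Ed [a a0 Ea] [b b0 Eb] Aij Aji] [Bki Bkj Bli Blj]] c1 e1 Ed' Dik Dil Djk Djl.
have hg := as3_fg h; have h2 := as3_half h.
have mdi : m (d - i) by rewrite (_ : d - i = f + j); [case: (as3_pfi h)|lia].
have mdj : m (d - j) by rewrite (_ : d - j = f + i); [case: (as3_pfi h)|lia].
have c0 : 0 <= c by lia. have e0 : 0 <= e by lia.
have Eds : d = e * l + c * k by lia.
have comm x y : f + g + x + y - d = f + g + y + x - d by lia.
rewrite comm in Dik; rewrite comm in Dil; rewrite comm in Djk; rewrite comm in Djl.
have [u [s [[hu hs C1 C2] _]]] := as3_corner h2 c0 e1 Ed' mdi mdj Dik Djk Dil Djl.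
have [v [t [[hv ht D1 D2] _]]] := as3_corner (as3_swap h2) e0 c1 Eds mdi mdj Dil Djl Dik Djk.
have Eu : u = g by case: hu => // E; subst u; case: hs => E; subst s; clash h.
have Ev : v = g by case: hv => // E; subst v; case: ht => E; subst t; clash h.
subst u v.
have [_ _ mfk _] := as3_pfi h; have [_ nf _] := as_fg h.
have [_ njk _] := as_minj h; have [nki nkj _] := as_mink h; have [_ nik _] := as_mini h.
have Akl : ~ m (f + k - l) by exact: as3_excl hg C2.
have Aki : m (f + k - i).
  apply: contrapT => nA; have [x x0 Ex] : exists2 x, 0 <= x & f + k = x * j.
    by apply: (as3_pure (as3_rot h)) => //; rewrite Z.add_simpl_r.
  exact: as3_same_col (as3_rot h) nki nik Ex Eb.
have Akj : m (f + k - j).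
  apply: contrapT => nA; have [x x0 Ex] : exists2 x, 0 <= x & f + k = x * i.
    by apply: (as3_pure h) => //; rewrite Z.add_simpl_r.
  exact: as3_same_col h nkj njk Ex Ea.
by case: hs => E; subst s; clash h.
Qed.

(** Both pairs must use the same [u], so [i + j = k + l]. No generator can then be subtracted from
    [g + k - j] or [g + l - j]; both vanish and [k = l]. *)
Lemma as3_pure_pure m f g u u' i j k l d : as3 m f g i j k l ->
  pure_pair m f g i j k l d -> u = f /\ u' = g \/ u = g /\ u' = f ->
  ~ pure_pair m u u' k l i j d.
Proof.
move=> h [[Ed _ _ Aij Aji] [Bki Bkj Bli Blj]] hu [[Ed' _ _ Akl Alk] [Bik Bjk Bil Bjl]].
have hg := as3_fg h.
case: hu => -[? ?]; subst u u'; last by clash h.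
have [_ _ ng] := as_fg h.
have [mi mj mk ml] := as_gens h.
have zero x y : m x -> m y -> k + l = x + y -> m (g + x - j) -> ~ m (g + x - y) ->
      (m (g + x - j - k) \/ m (g + x - j - l) -> m (g + x - j - x) \/ m (g + x - j - y)) ->
      g + x = j.
  move=> mx my Exy mxj nxy kl; have Ex : g + x - j = g + i - y by lia.
  have nij := as3_excl h Aji.
  have side : ~ (m (g + x - j - k) \/ m (g + x - j - l)).
    case/kl => n; first by case: ng; rewrite (_ : g = g + x - j - x + j); [apply: (asD h)|lia].
    by apply: nxy; rewrite (_ : g + x - y = g + x - j - y + j); [apply: (asD h)|lia].
  case: (as_split h mxj) => [[|n]|n|n|n]; first by lia.
  - by case: ng; rewrite (_ : g = g + x - j - i + y); [apply: (asD h)|lia].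
  - by case: nij; rewrite (_ : g + i - j = g + x - j - j + y); [apply: (asD h)|lia].
  - by case: side; left.
  - by case: side; right.
have Ek : g + k = j by apply: (zero k l) => //; exact: as3_excl h Alk.
have El : g + l = j by apply: (zero l k) => //; [lia|exact: as3_excl h Akl|tauto].
by have [_ [_ _ nkl]] := as_neq h; lia.
Qed.

(** Each side is mixed or a pure pair. Only mixed against mixed survives, and [as3_square_mixed1]
    read from both sides makes all four exponents 1. *)
Lemma as3_square m f g i j k l d : as3 m f g i j k l ->
  m (d - i) \/ m (d - j) -> m (d - k) \/ m (d - l) ->
  m (f + g + i + k - d) -> m (f + g + i + l - d) ->
  m (f + g + j + k - d) -> m (f + g + j + l - d) -> d = i + j /\ d = k + l.
Proof.
move=> h ms mt Dik Dil Djk Djl; have h2 := as3_half h.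
have comm x y : f + g + x + y - d = f + g + y + x - d by lia.
have Dki := Dik; have Dli := Dil; have Dkj := Djk; have Dlj := Djl.
rewrite comm in Dki; rewrite comm in Dli; rewrite comm in Dkj; rewrite comm in Dlj.
case: (as3_side h ms mt Dik Dil Djk Djl); case: (as3_side h2 mt ms Dki Dkj Dli Dlj).
- move=> [c [e [c1 e1 Ed']]] [a [b [a1 b1 Ed]]].
  have [? ?] := as3_square_mixed1 h a1 b1 c1 e1 Ed Ed' Dik Dil Djk Djl.
  have [? ?] := as3_square_mixed1 h2 c1 e1 a1 b1 Ed' Ed Dki Dkj Dli Dlj.
  by subst a b c e; lia.
- move=> [u [u' [hu hp]]] [a [b [a1 b1 Ed]]]; exfalso.
  case: hu => -[? ?]; subst u u'.
    exact: (as3_pure_mixed h2 hp a1 b1 Ed).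
  move: Dki Dkj Dli Dlj; rewrite (Z.add_comm f) => *.
  exact: (as3_pure_mixed (as3_fg h2) hp a1 b1 Ed).
- move=> [a [b [a1 b1 Ed]]] [u [u' [hu hp]]]; exfalso.
  case: hu => -[? ?]; subst u u'.
    exact: (as3_pure_mixed h hp a1 b1 Ed).
  move: Dik Dil Djk Djl; rewrite (Z.add_comm f) => *.
  exact: (as3_pure_mixed (as3_fg h) hp a1 b1 Ed).
- move=> [v [v' [hv hq]]] [u [u' [hu hp]]]; exfalso.
  case: hu => -[? ?]; subst u u'.
    exact: (as3_pure_pure h hp hv hq).
  by apply: (as3_pure_pure (as3_fg h) hp _ hq); tauto.
Qed.

End Semigroups.

(** * Graphs on four vertices *)

Section Graphs.
Local Open Scope nat_scope.

Fixpoint words (T : Type) (a : seq T) n : seq (seq T) :=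
  if n is n'.+1 then [seq x :: s | x <- a, s <- words a n'] else [:: [::]].

Lemma mem_words (T : eqType) (a s : seq T) : {subset s <= a} -> s \in words a (size s).
Proof.
elim: s => [|x s IH] sub //=; apply/allpairsP; exists (x, s); split=> //=.
  by apply: sub; rewrite inE eqxx.
by apply: IH => y ys; apply: sub; rewrite inE ys orbT.
Qed.

(* Graphs on [0, 3] are listed by their edges in the order 01, 02, 03, 12, 13,
   23, so that reversing a list exchanges opposite edges. *)
Definition edge_index i j :=
  nth 6 (nth [::] [:: [:: 6; 0; 1; 2]; [:: 0; 6; 3; 4]; [:: 1; 3; 6; 5]; [:: 2; 4; 5; 6]] i) j.

Definition adj (E : seq bool) i j := nth false E (edge_index i j).

(** Composing twice yields walks of length at most 4, which exhaust a component on four vertices;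
    [rep] is its least vertex. *)
Definition reach1 E i j := (i == j) || adj E i j.
Definition reach2 E i j := has (fun k => reach1 E i k && reach1 E k j) (iota 0 4).
Definition reach E i j := has (fun k => reach2 E i k && reach2 E k j) (iota 0 4).
Definition rep E i := find (reach E i) (iota 0 4).

Definition ncomp (V E : seq bool) :=
  count (fun i => nth false V i && (rep E i == i)) (iota 0 4).
Definition corank E := ncomp (nseq 4 true) E.

Lemma rep_adj E i j : size E = 6 -> i < 4 -> j < 4 -> adj E i j -> rep E i = rep E j.
Proof.
move=> sE; have : all (fun E => all (fun i => all (fun j => adj E i j ==> (rep E i == rep E j))
  (iota 0 4)) (iota 0 4)) (words [:: true; false] 6) by vm_compute.
move=> /allP/(_ E) H i4 j4; have {}H : all (fun i => all (fun j => adj E i j ==> (rep E i == rep E j))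
  (iota 0 4)) (iota 0 4) by apply: H; rewrite -sE; apply: mem_words => -[].
move: H => /allP/(_ i); rewrite mem_iota => /(_ i4)/allP/(_ j); rewrite mem_iota => /(_ j4).
by move=> /implyP H /H/eqP.
Qed.

Lemma rep_ltn E i : i < 4 -> rep E i < 4.
Proof.
move=> i4; rewrite /rep -[X in _ < X](size_iota 0 4) -has_find.
have rr k : k < 4 -> reach1 E k k by rewrite /reach1 eqxx.
by apply/hasP; exists i; rewrite ?mem_iota //; apply/hasP; exists i; rewrite ?mem_iota //;
  apply/andP; split; apply/hasP; exists i; rewrite ?mem_iota // rr.
Qed.

Lemma reach_rep E i : i < 4 -> reach E i (rep E i).
Proof.
move=> i4; have := rep_ltn E i4; rewrite /rep => lt; have := nth_find 0 (s := iota 0 4) (a := reach E i).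
rewrite has_find size_iota => /(_ lt); rewrite nth_iota //.
Qed.

Lemma rep_rel E (R : nat -> nat -> Prop) i :
  (forall i, i < 4 -> R i i) -> (forall i j k, R i j -> R j k -> R i k) ->
  (forall i j, i < 4 -> j < 4 -> adj E i j -> R i j) -> i < 4 -> R i (rep E i).
Proof.
move=> Rr Rt Re i4; have r1 a b : a < 4 -> b < 4 -> reach1 E a b -> R a b.
  by move=> a4 b4; case/orP => [/eqP<-|]; [apply: Rr|apply: Re].
have r2 a b : a < 4 -> b < 4 -> reach2 E a b -> R a b.
  move=> a4 b4 /hasP [k]; rewrite mem_iota => k4 /andP [? ?].
  by apply: (Rt _ k); apply: r1.
have /hasP [k] := reach_rep E i4; rewrite mem_iota => k4 /andP [? ?].
by apply: (Rt _ k); apply: r2 => //; apply: rep_ltn.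
Qed.

Lemma rep_rep E i : size E = 6 -> i < 4 -> rep E (rep E i) = rep E i.
Proof.
move=> sE i4; apply/esym; apply: (rep_rel (R := fun a b => rep E a = rep E b)) => // [a b c -> //|a b a4 b4].
exact: rep_adj.
Qed.

Definition is_state (c : nat) (s : seq nat) := [seq x == c | x <- s].
Definition joined (s : seq nat) := [seq 0 < x | x <- s].
(* [0]: no edge, [1]: an edge, [2]: a label; opposite edges have dual states. *)
Definition dual_state (s : seq nat) := rev [seq nth 0 [:: 1; 0; 2] x | x <- s].
Definition gain s := corank (is_state 1 s) - corank (joined s).

(** In the cycle matroid of K_4, [gain] is the rank of edges and labels minus the rank of the edges;
    the rank formula for the dual matroid turns the sum into the number of labels. The proof checks
    all 3^6 lists. *)
Lemma gain_dual s : size s = 6 -> {subset s <= [:: 0; 1; 2]} ->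
  gain s + gain (dual_state s) = count_mem 2 s.
Proof.
move=> sz sub; have : all (fun s => gain s + gain (dual_state s) == count_mem 2 s) (words [:: 0; 1; 2] 6).
  by vm_compute.
by move=> /allP/(_ s) H; apply/eqP/H; rewrite -sz; apply: mem_words.
Qed.

Definition cut (V : seq bool) (s : seq nat) (T : seq bool) :=
  [&& has (fun i => nth false V i && nth false T i) (iota 0 4),
      has (fun i => nth false V i && ~~ nth false T i) (iota 0 4)
    & all (fun i => all (fun j => [&& nth false T i & ~~ nth false T j] ==> ~~ adj (joined s) i j)
        (iota 0 4)) (iota 0 4)].

Definition supported (V : seq bool) (s : seq nat) :=
  all (fun i => all (fun j => adj (joined s) i j ==> nth false V i) (iota 0 4)) (iota 0 4).

(** The splitting of [n1], [n4] from [n2], [n3], the only one that the order of the generators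
    permits. *)
Definition cut0 := [:: true; false; false; true].

(** Without other cuts, edges and labels leave at most two components on [V]. Vertices outside [V]
    are isolated with and without the labels, so [gain] counts merges inside [V]. Again a finite
    check. *)
Lemma ncomp_le_gain V s : size V = 4 -> size s = 6 -> {subset s <= [:: 0; 1; 2]} -> supported V s ->
  (forall T, size T = 4 -> cut V s T -> (T == cut0) || (T == map negb cut0)) ->
  ncomp V (is_state 1 s) <= (gain s + cut V s cut0).+1.
Proof.
move=> sV sz sub sup cuts.
have : all (fun V => all (fun s => supported V s ==>
   (all (fun T => cut V s T ==> (T == cut0) || (T == map negb cut0)) (words [:: true; false] 4)) ==>
   (ncomp V (is_state 1 s) <= (gain s + cut V s cut0).+1))
   (words [:: 0; 1; 2] 6)) (words [:: true; false] 4).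
  by vm_compute.
have inV : V \in words [:: true; false] 4 by rewrite -sV; apply: mem_words => -[].
have ins : s \in words [:: 0; 1; 2] 6 by rewrite -sz; apply: mem_words.
move=> /allP/(_ _ inV)/allP/(_ _ ins)/implyP/(_ sup)/implyP; apply.
apply/allP => T Tw; apply/implyP; apply: cuts.
by have := allP (erefl : all (fun T : seq bool => size T == 4) (words [:: true; false] 4)) _ Tw => /eqP.
Qed.

End Graphs.

(** * Minimal generators of a toric ideal *)

Section Ideals.
Local Open Scope classical_set_scope.
Local Open Scope ring_scope.
Context (K : fieldType) (e : nat).
Implicit Types (p q : {mpoly K[e]}) (s t : seq {mpoly K[e]}).

Lemma ideal_gen_nth s (i : 'I_(size s)) : ideal_gen s s`_i.
Proof.
exists (fun j => (j == i)%:R); rewrite (bigD1 i) //= eqxx mul1r big1 ?addr0 // => j /negPf ->.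
by rewrite mul0r.
Qed.

Lemma ideal_gen_mem s p : p \in s -> ideal_gen s p.
Proof.
move=> ps; have lt : (index p s < size s)%N by rewrite index_mem.
by have := ideal_gen_nth (Ordinal lt); rewrite /= nth_index.
Qed.

Lemma ideal_gen0 s : ideal_gen s 0.
Proof. by exists (fun _ => 0); rewrite big1 // => i _; rewrite mul0r. Qed.

Lemma ideal_genD s p q : ideal_gen s p -> ideal_gen s q -> ideal_gen s (p + q).
Proof.
move=> [c ->] [c' ->]; exists (fun i => c i + c' i); rewrite -big_split /=.
by apply: eq_bigr => i _; rewrite mulrDl.
Qed.

Lemma ideal_genM s p q : ideal_gen s q -> ideal_gen s (p * q).
Proof.
move=> [c ->]; exists (fun i => p * c i); rewrite mulr_sumr.
by apply: eq_bigr => i _; rewrite mulrA.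
Qed.

Lemma ideal_gen_sum s (I : Type) (r : seq I) (P : pred I) (F : I -> {mpoly K[e]}) :
  (forall i, P i -> ideal_gen s (F i)) -> ideal_gen s (\sum_(i <- r | P i) F i).
Proof.
by move=> H; elim/big_ind: _ => //; [exact: ideal_gen0|exact: ideal_genD].
Qed.

Lemma ideal_gen_sub s t : (forall p, p \in s -> ideal_gen t p) -> ideal_gen s `<=` ideal_gen t.
Proof.
move=> st p [c ->]; apply: ideal_gen_sum => i _; apply/ideal_genM/st.
exact: mem_nth.
Qed.

Context (n : 'I_e -> nat).
Context (n_gt0 : forall i, (0 < n i)%N).

Lemma mmap_toricX (m : 'X_{1..e}) :
  mmap (@polyC K) (fun i => 'X^(n i)) 'X_[m] = 'X^(wdeg n m).
Proof.
rewrite mmapX /mmap1 /wdeg (big_morph (fun k => 'X^k : {poly K}) (exprD 'X) (expr0 'X)).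
by apply: eq_bigr => i _; rewrite mulnC exprM.
Qed.

Lemma toric_sum (I : Type) (r : seq I) (P : pred I) (F : I -> {mpoly K[e]}) :
  (forall i, P i -> toric_ideal K n (F i)) -> toric_ideal K n (\sum_(i <- r | P i) F i).
Proof.
move=> H; rewrite /toric_ideal /= raddf_sum big1 // => i /H.
Qed.

Lemma toricM p q : toric_ideal K n q -> toric_ideal K n (p * q).
Proof.
rewrite /toric_ideal /= => Hq.
by rewrite (rmorphM (mmap (@polyC K) (fun i : 'I_e => 'X^(n i)))) /= Hq mulr0.
Qed.

Lemma toric_binomial (m m' : 'X_{1..e}) : wdeg n m = wdeg n m' ->
  toric_ideal K n ('X_[m] - 'X_[m']).
Proof. by move=> E; rewrite /toric_ideal /= mmapB !mmap_toricX E subrr. Qed.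

(** Every monomial of [p] maps to the same power ['X^d]. *)
Lemma toric_coef_sum p d k : p \is d.-homog for (wdeg n) -> toric_ideal K n p -> (msize p <= k)%N ->
  \sum_(m : 'X_{1..e < k}) p@_m = 0.
Proof.
move=> hp Ip le; have : mmap (@polyC K) (fun i => 'X^(n i)) p = (\sum_(m : 'X_{1..e < k}) p@_m) *: 'X^d.
  rewrite {1}(mpolywE le) raddf_sum scaler_suml; apply: eq_bigr => m _ /=.
  rewrite mmapZ mmap_toricX mul_polyC; have [->|nz] := eqVneq p@_m 0; first by rewrite !scale0r.
  by rewrite (dhomog_mf hp) // mcoeff_msupp.
rewrite Ip => /esym/eqP; rewrite scaler_eq0 => /orP [/eqP //|].
by rewrite -size_poly_eq0 size_polyXn.
Qed.

Lemma toric_dhomog0 p : p \is 0.-homog for (wdeg n) -> toric_ideal K n p -> p = 0.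
Proof.
move=> hp; have Ep : p = (p@_0)%:MP.
  apply/mpolyP => m; rewrite mcoeffC; have [->|m0] := eqVneq m 0%MM; first by rewrite mulr1.
  rewrite mulr0 (dhomog_nemf_coeff hp) //; apply: contra m0 => /eqP E; apply/eqP/mnmP => i.
  move: E; rewrite mnm0E /= /wdeg (bigD1 i) //= => /eqP; rewrite addn_eq0 => /andP [+ _].
  by rewrite muln_eq0 (gtn_eqF (n_gt0 i)) orbF => /eqP.
rewrite Ep /toric_ideal /= mmapC => /eqP; rewrite polyC_eq0 => /eqP ->.
by rewrite mpolyC0.
Qed.

(* Membership in [m I], where [m] is generated by the variables. *)
Definition max_toric p := exists2 q : 'I_e -> {mpoly K[e]},
  forall i, toric_ideal K n (q i) & p = \sum_i 'X_i * q i.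

Lemma max_toric0 : max_toric 0.
Proof.
exists (fun _ => 0) => [i|]; first by rewrite /toric_ideal /= mmap0.
by rewrite big1 // => i _; rewrite mulr0.
Qed.

Lemma max_toricD p q : max_toric p -> max_toric q -> max_toric (p + q).
Proof.
move=> [a Ia ->] [b Ib ->]; exists (fun i => a i + b i) => [i|].
  by rewrite /toric_ideal /= mmapD Ia Ib addr0.
by rewrite -big_split; apply: eq_bigr => i _; rewrite mulrDr.
Qed.

Lemma max_toric_sum (I : Type) (r : seq I) (P : pred I) (F : I -> {mpoly K[e]}) :
  (forall i, P i -> max_toric (F i)) -> max_toric (\sum_(i <- r | P i) F i).
Proof.
by move=> H; elim/big_ind: _ => //; [exact: max_toric0|exact: max_toricD].
Qed.

Lemma max_toricZ (c : K) p : max_toric p -> max_toric (c *: p).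
Proof.
move=> [q Iq ->]; exists (fun i => c *: q i) => [i|].
  by rewrite /toric_ideal /= mmapZ Iq mulr0.
by rewrite scaler_sumr; apply: eq_bigr => i _; rewrite scalerAr.
Qed.

Lemma max_toricX i q : toric_ideal K n q -> max_toric ('X_i * q).
Proof.
move=> Iq; exists (fun j => if j == i then q else 0) => [j|].
  by case: ifP => // _; rewrite /toric_ideal /= mmap0.
rewrite (bigD1 i) //= eqxx big1 ?addr0 // => j /negPf ->; exact: mulr0.
Qed.

Lemma max_toric_binomial i (m m' : 'X_{1..e}) : (0 < m i)%N -> (0 < m' i)%N ->
  wdeg n m = wdeg n m' -> max_toric ('X_[m] - 'X_[m']).
Proof.
move=> mi mi' E.
have [Em Em'] : m = (U_(i) + (m - U_(i)))%MM /\ m' = (U_(i) + (m' - U_(i)))%MM.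
  by split; rewrite addmC submK // lep1mP -lt0n.
rewrite Em Em' !mpolyXD -mulrBr; apply: max_toricX; apply: toric_binomial.
by apply: (@addnI (wdeg n U_(i))); rewrite -!mfD -Em -Em'.
Qed.

Lemma pihomogM d f p q : q \is f.-homog for (wdeg n) ->
  pihomog (wdeg n) d (p * q) = if (f <= d)%N then pihomog (wdeg n) (d - f) p * q else 0.
Proof.
move=> hq; rewrite {1}(pihomog_partitionE (mf := wdeg n) (p := p) (leqnn _)) mulr_suml raddf_sum /=.
have hk (k : nat) : pihomog (wdeg n) k p * q \is (k + f).-homog for (wdeg n).
  by apply: dhomogM => //; apply: pihomogP.
have term (k : nat) : pihomog (wdeg n) d (pihomog (wdeg n) k p * q) =
    if (f <= d)%N && (k == d - f)%N then pihomog (wdeg n) k p * q else 0.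
  case: ifP => [/andP [fd /eqP Ek]|nk].
    by apply: pihomog_dE; have := hk k; rewrite {2}Ek subnK.
  apply: (pihomog_ne0 _ (hk k)); apply: contraFN nk => /eqP <-.
  by rewrite leq_addl addnK eqxx.
under eq_bigr => k _ do rewrite term.
case: ifP => fd /=; last by rewrite big1.
rewrite -big_mkcond /= -mulr_suml; congr (_ * q).
have [lt|ge] := ltnP (d - f) (mmeasure (wdeg n) p).
  by rewrite (big_pred1 (Ordinal lt)).
rewrite big_pred0 => [|k]; last by apply/negbTE; rewrite neq_ltn (leq_trans (ltn_ord k) ge).
rewrite pihomogE big_seq_cond big1 // => m /andP [mp /eqP Em].
by have := @mmeasure_mnm_lt _ _ (wdeg n) _ _ mp; rewrite Em ltnNge ge.
Qed.

Lemma minimal_homog_redundant s (t0 : 'I_(size s)) (b : 'I_(size s) -> {mpoly K[e]}) :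
  minimal_homog_generators n (toric_ideal K n) s ->
  s`_t0 = \sum_(t | t != t0) b t * s`_t -> False.
Proof.
move=> [_ gen min] E; pose s' := take t0 s ++ drop t0.+1 s.
have sub : subseq s' s.
  rewrite -[X in subseq _ X](cat_take_drop t0 s) cat_subseq //.
  by rewrite (drop_nth 0 (ltn_ord t0)) subseq_cons.
have mem (t : 'I_(size s)) : t != t0 -> s`_t \in s'.
  rewrite mem_cat neq_ltn => /orP [lt|gt].
    by rewrite -(nth_take 0 lt) mem_nth // size_take ltn_ord.
  apply/orP; right; rewrite -(subnKC gt) -nth_drop mem_nth //.
  by rewrite size_drop; exact: ltn_sub2r (leq_ltn_trans gt (ltn_ord t)) (ltn_ord t).
have gen' : ideal_gen s' = toric_ideal K n.
  rewrite -gen; apply/seteqP; split; apply: ideal_gen_sub => p.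
    by move=> /(mem_subseq sub)/ideal_gen_mem.
  move=> /(nthP 0) [i lt <-]; have [Ei|ne] := eqVneq i t0.
    rewrite Ei E; apply: ideal_gen_sum => t /mem mt.
    exact/ideal_genM/ideal_gen_mem.
  exact/ideal_gen_mem/(mem (Ordinal lt)).
have /(congr1 size) := min _ sub gen'.
have lt := ltn_ord t0; rewrite size_cat size_take lt size_drop => Es.
by have := subnKC lt; rewrite addSn Es => /esym/n_Sn.
Qed.

End Ideals.

(** * The graded Nakayama argument *)

Section Nakayama.
Local Open Scope classical_set_scope.
Local Open Scope ring_scope.
Context (K : fieldType) (e : nat) (n : 'I_e -> nat) (s : seq {mpoly K[e]}).
Context (n_gt0 : forall i, (0 < n i)%N).
Context (min_s : minimal_homog_generators n (toric_ideal K n) s).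

Lemma minimal_homog_toric (t : 'I_(size s)) : toric_ideal K n s`_t.
Proof. by case: min_s => _ <- _; apply: ideal_gen_nth. Qed.

Lemma minimal_homog_neq0 (t : 'I_(size s)) : s`_t != 0.
Proof.
apply/eqP => E; apply: (minimal_homog_redundant (t0 := t) (b := fun _ => 0) min_s).
by rewrite E big1 // => i _; rewrite mul0r.
Qed.

Lemma minimal_homog_dhomog (t : 'I_(size s)) :
  s`_t \is ((mmeasure (wdeg n) s`_t).-1).-homog for (wdeg n).
Proof. by case: min_s => /(_ _ (mem_nth 0 (ltn_ord t))). Qed.

(** Membership in [max_toric] gives a relation among the generators whose coefficient at [t0] is
    [c t0] minus a combination of the variables. Its part of degree [d] keeps only the constant
    there, so the generator at [t0] is redundant. *)
Lemma minimal_homog_free d (c : 'I_(size s) -> K) (t0 : 'I_(size s)) :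
  (forall t, c t != 0 -> s`_t \is d.-homog for (wdeg n)) -> c t0 != 0 ->
  ~ max_toric n (\sum_t c t *: s`_t).
Proof.
move=> hom c0 [q Iq Eq].
have /fin_all_exists [a Ea] : forall i, exists a : 'I_(size s) -> {mpoly K[e]}, q i = \sum_t a t * s`_t.
  by move=> i; have := Iq i; case: min_s => _ <- _ [a Ea]; exists a.
pose B t := (c t)%:MP - \sum_i a i t * 'X_i.
have sumB : \sum_t B t * s`_t = 0.
  apply/eqP; under eq_bigr do rewrite mulrBl mul_mpolyC; rewrite sumrB subr_eq0 Eq.
  under eq_bigr do rewrite Ea mulr_sumr; rewrite exchange_big /=; apply/eqP/eq_bigr => t _.
  by rewrite mulr_suml; apply: eq_bigr => i _; rewrite mulrA [_ * 'X_i]mulrC.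
(* Coefficients of the degree-[d] part of the relation; they vanish at generators of degree above
   [d]. *)
pose b (t : 'I_(size s)) := if ((mmeasure (wdeg n) s`_t).-1 <= d)%N
  then pihomog (wdeg n) (d - (mmeasure (wdeg n) s`_t).-1) (B t) else 0.
have sumb : \sum_t b t * s`_t = 0.
  have := congr1 (pihomog (wdeg n) d) sumB; rewrite pihomog0 raddf_sum /= => E.
  rewrite -[RHS]E; apply: eq_bigr => t _; rewrite (pihomogM _ _ (minimal_homog_dhomog t)) /b.
  by case: ifP => // _; rewrite mul0r.
have Ed : (mmeasure (wdeg n) s`_t0).-1 = d.
  exact: dhomog_uniq (minimal_homog_neq0 t0) (minimal_homog_dhomog t0) (hom _ c0).
have Eb : b t0 = (c t0)%:MP.
  have X0 : pihomog (wdeg n) 0 (\sum_i a i t0 * 'X_i) = 0.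
    rewrite raddf_sum big1 //= => i _.
    have hX : ('X_i : {mpoly K[e]}) \is (n i).-homog for (wdeg n).
      rewrite dhomogX /= /wdeg (bigD1 i) //= mnm1E eqxx mul1n big1 ?addn0 // => j /negPf.
      by rewrite mnm1E eq_sym => ->.
    by rewrite (pihomogM _ _ hX) leqNgt n_gt0.
  rewrite /b Ed leqnn subnn /B pihomogB X0 subr0.
  by apply: pihomog_dE; rewrite -[_%:MP]mulr1 mul_mpolyC dhomogZ // dhomog1.
apply: (minimal_homog_redundant (t0 := t0) (b := fun t => - (c t0)^-1 *: b t) min_s).
move: sumb; rewrite (bigD1 t0) //= Eb mul_mpolyC => /eqP; rewrite addr_eq0 => /eqP E.
rewrite -[LHS](scalerK c0) E scalerN scaler_sumr -sumrN; apply: eq_bigr => t _.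
by rewrite -scalerAl scaleNr.
Qed.

End Nakayama.

(** * Generators of one degree and components of its graph *)

Section Components.
Local Open Scope classical_set_scope.
Local Open Scope ring_scope.
Context (K : fieldType) (n : 'I_4 -> nat) (s : seq {mpoly K[4]}).
Context (n_gt0 : forall i, (0 < n i)%N).
Context (min_s : minimal_homog_generators n (toric_ideal K n) s).
Context (d : nat) (d_gt0 : (0 < d)%N) (V E : seq bool) (sizeV : size V = 4%N) (sizeE : size E = 6%N).
Context (V_mnm : forall i : 'I_4, nth false V i -> exists m : 'X_{1..4}, wdeg n m = d /\ (0 < m i)%N).
Context (mnm_V : forall (m : 'X_{1..4}) (i : 'I_4), wdeg n m = d -> (0 < m i)%N -> nth false V i).
Context (E_mnm : forall i j : 'I_4, adj E i j ->
  exists m : 'X_{1..4}, [/\ wdeg n m = d, (0 < m i)%N & (0 < m j)%N]).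
Context (mnm_E : forall (m : 'X_{1..4}) (i j : 'I_4), i != j -> wdeg n m = d ->
  (0 < m i)%N -> (0 < m j)%N -> adj E i j).

(** Any variable of a monomial of weight [d] would do, since its variables are pairwise adjacent.
    The default [ord0] concerns only the constant monomial. *)
Let comp (m : 'X_{1..4}) : nat := rep E (odflt ord0 [pick i | 0 < m i]%N).

Lemma comp_eq m (i : 'I_4) : wdeg n m = d -> (0 < m i)%N -> comp m = rep E i.
Proof.
move=> md mi; rewrite /comp; case: pickP => [j mj|/(_ i)]; last by rewrite mi.
have [->//|ne] := eqVneq j i; apply: rep_adj => //; exact: mnm_E ne md mj mi.
Qed.

Lemma mnm_gt0 m : wdeg n m = d -> exists i : 'I_4, (0 < m i)%N.
Proof.
move=> md; have [i mi|m0] := pickP (fun i : 'I_4 => 0 < m i)%N; first by exists i.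
by move: d_gt0; rewrite -md /wdeg big1 // => i _; move/negbT: (m0 i); rewrite -eqn0Ngt => /eqP->.
Qed.

Lemma V_rep (i : 'I_4) : nth false V i -> nth false V (rep E i).
Proof.
apply: (rep_rel (E := E) (R := fun a b => nth false V a -> nth false V b)) => // [a b c ab bc /ab//|a b a4 b4 ab _].
have [m [md _ mb]] := E_mnm (i := Ordinal a4) (j := Ordinal b4) ab.
exact: (mnm_V (i := Ordinal b4) md mb).
Qed.

(** Each edge of a walk from [i] to its representative provides a monomial; consecutive monomials
    share a variable, and the differences telescope. *)
Lemma max_toric_rep (i : 'I_4) (m m' : 'X_{1..4}) : nth false V i ->
  wdeg n m = d -> wdeg n m' = d -> (0 < m i)%N -> (0 < m' (inord (rep E i)))%N ->
  max_toric n ('X_[m] - 'X_[m'] : {mpoly K[4]}).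
Proof.
pose R a b := (a = b \/ nth false V a /\ nth false V b) /\
  forall m m' : 'X_{1..4}, wdeg n m = d -> wdeg n m' = d ->
  (0 < m (inord a))%N -> (0 < m' (inord b))%N -> max_toric n ('X_[m] - 'X_[m'] : {mpoly K[4]}).
move=> Vi md m'd mi m'i; suff [_] : R i (rep E i) by apply; rewrite ?inord_val.
apply: rep_rel => // {m m' md m'd mi m'i} [a a4|a b c [Vab Rab] [Vbc Rbc]|a b a4 b4 ab].
- split=> [|m m' md m'd ma m'a]; first by left.
  by apply: (max_toric_binomial _ ma m'a); rewrite md.
- case: Vab => [->//|[Va Vb]]; case: Vbc => [<-//|[_ Vc]].
    by split=> //; right.
  split=> [|m m' md m'd ma m'c]; first by right.
  have b4 : (b < 4)%N by rewrite -sizeV ltnNge; apply: contraL Vb => /(nth_default false)->.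
  have [m'' [m''d m''b]] := V_mnm (i := Ordinal b4) Vb.
  have Eb : inord b = Ordinal b4 by apply: val_inj; rewrite /= inordK.
  rewrite -Eb in m''b; rewrite -(subrKA 'X_[m'']).
  by apply: max_toricD; [exact: Rab|exact: Rbc].
- have [Ea Eb] : inord a = Ordinal a4 /\ inord b = Ordinal b4.
    by split; apply: val_inj; rewrite /= inordK.
  have [m [md ma mb]] := E_mnm (i := Ordinal a4) (j := Ordinal b4) ab.
  have [Va Vb] := (mnm_V (i := Ordinal a4) md ma, mnm_V (i := Ordinal b4) md mb).
  split=> [|m1 m2 m1d m2d m1a m2b]; first by right.
  rewrite Ea in m1a; rewrite Eb in m2b; rewrite -(subrKA 'X_[m]).
  by apply: max_toricD; [apply: (max_toric_binomial _ m1a ma)|apply: (max_toric_binomial _ mb m2b)]; rewrite md.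
Qed.

Definition roots : seq nat := [seq i <- iota 0 4 | nth false V i && (rep E i == i)].

Lemma size_roots : size roots = ncomp V E.
Proof. exact: size_filter. Qed.

Lemma comp_roots m : wdeg n m = d -> comp m \in roots.
Proof.
move=> md; have [i mi] := mnm_gt0 md; rewrite (comp_eq md mi) mem_filter mem_iota.
by rewrite rep_rep // rep_ltn // eqxx V_rep // (mnm_V md mi).
Qed.

(** Subtracting from each monomial a fixed monomial of its component leaves [p] unchanged when the
    coefficients of each component sum to zero, and the resulting binomials lie in [max_toric]. *)
Lemma max_toric_comp k (p : {mpoly K[4]}) : (msize p <= k)%N -> p \is d.-homog for (wdeg n) ->
  (forall r, \sum_(m : 'X_{1..4 < k} | comp m == r) p@_m = 0) -> max_toric n p.
Proof.
move=> le hp sum0.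
have /fin_all_exists [M HM] : forall r : 'I_4, exists m : 'X_{1..4},
    nth false V r -> wdeg n m = d /\ (0 < m r)%N.
  move=> r; case: (boolP (nth false V r)) => [/V_mnm [m Hm]|_]; first by exists m.
  by exists 0%MM.
have Ep : p = \sum_(m : 'X_{1..4 < k}) p@_m *: ('X_[m] - 'X_[M (inord (comp m))]).
  rewrite {1}(mpolywE le) -[LHS]subr0.
  rewrite [RHS](eq_bigr (fun m : 'X_{1..4 < k} => p@_m *: 'X_[m] - p@_m *: 'X_[M (inord (comp m))])).
    rewrite sumrB; congr (_ - _); apply/esym.
    rewrite (partition_big (fun m : 'X_{1..4 < k} => inord (comp m) : 'I_4) xpredT) //=.
    rewrite big1 // => r _.
    rewrite (eq_bigr (fun m : 'X_{1..4 < k} => p@_m *: 'X_[M r])) => [|m /eqP -> //].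
    rewrite -scaler_suml (eq_bigl (fun m : 'X_{1..4 < k} => comp m == r)) ?sum0 ?scale0r // => m.
    by rewrite -(inj_eq val_inj) /= inordK // rep_ltn.
  by move=> m _; rewrite scalerBr.
rewrite Ep; apply: max_toric_sum => m _; have [->|nz] := eqVneq p@_m 0.
  by rewrite scale0r; apply: max_toric0.
apply: max_toricZ; have md : wdeg n m = d by apply: (dhomog_mf hp); rewrite mcoeff_msupp.
have [i mi] := mnm_gt0 md; have Vi := mnm_V md mi.
have Ei := comp_eq md mi; have Vr := V_rep Vi.
have Er : nat_of_ord (inord (comp m) : 'I_4) = rep E i by rewrite Ei inordK // rep_ltn.
have [Md Mr] := HM (inord (comp m)) (eq_ind_r (fun x => nth false V x) Vr Er).
apply: (max_toric_rep Vi md Md mi); rewrite -Ei; exact: Mr.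
Qed.

(** With more generators, some nontrivial combination [p] has coefficient sum zero on all components
    but one, and on the last as well because [p] is in the toric ideal. Then [p] is in [max_toric],
    against [minimal_homog_free]. *)
Lemma count_generators :
  (count (fun p => p \is d.-homog for (wdeg n)) s <= (ncomp V E).-1)%N.
Proof.
pose J := [set t : 'I_(size s) | s`_t \is d.-homog for (wdeg n)]%SET.
have -> : count (fun p => p \is d.-homog for (wdeg n)) s = #|J|.
  by rewrite -sum1_count (big_nth 0) big_mkord -sum1dep_card.
rewrite leqNgt; apply/negP => lt.
have J_gt0 : (0 < #|J|)%N by apply: leq_ltn_trans lt.
have hJ (t : 'I_#|J|) : s`_(enum_val t) \is d.-homog for (wdeg n).
  by have := enum_valP t; rewrite inE.
(* A generator of degree [d] is nonzero and has a monomial, so there is at least one component. *)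
have [r0 [R' ER]] : exists r0 R', roots = r0 :: R'.
  case ER: roots => [|r0 R']; last by exists r0, R'.
  have := minimal_homog_neq0 min_s (enum_val (Ordinal J_gt0)); rewrite -msupp_eq0.
  case Em: (msupp _) => [|m ms] // _; have := dhomog_mf (hJ (Ordinal J_gt0)) (x := m).
  by rewrite Em inE eqxx => /(_ isT)/comp_roots; rewrite ER.
rewrite -size_roots ER /= in lt.
pose k := (\max_(t : 'I_(size s)) msize s`_t)%N.
have le (t : 'I_(size s)) : (msize s`_t <= k)%N by apply: (leq_bigmax (F := fun t : 'I_(size s) => msize s`_t)).
pose sigma r (p : {mpoly K[4]}) := \sum_(m : 'X_{1..4 < k} | comp m == r) p@_m.
pose g (a : 'I_#|J|) : {mpoly K[4]} := s`_(enum_val a).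
(* Rows are the generators of degree [d], columns the components other than that of [r0]; there are
   more rows than columns. *)
pose A : 'M[K]_(#|J|, size R') := \matrix_(a, j) sigma (nth 0%N R' j) (g a).
have /rowV0Pn [u /sub_kermxP uA u0] : kermx A != 0.
  by rewrite kermx_eq0 /row_free neq_ltn (leq_ltn_trans (rank_leq_col A)).
pose p := \sum_a u 0 a *: g a.
have sigma_p r : sigma r p = \sum_a u 0 a * sigma r (g a).
  rewrite /sigma /p; under eq_bigr do rewrite raddf_sum /=; rewrite exchange_big /=.
  by apply: eq_bigr => a _; rewrite mulr_sumr; apply: eq_bigr => m _; rewrite mcoeffZ.
have hp : p \is d.-homog for (wdeg n).
  by apply: rpred_sum => a _; apply: dhomogZ; apply: hJ.
have Ip : toric_ideal K n p.
  by apply: toric_sum => a _; rewrite -mul_mpolyC; apply/toricM/minimal_homog_toric.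
have lep : (msize p <= k)%N.
  apply: leq_trans (mmeasure_sum _ _ _ _) _; apply/bigmax_leqP => a _.
  exact: leq_trans (mmeasureZ_le _ _ _) (le _).
have sigmaR r : r \in R' -> sigma r p = 0.
  move=> rR; have lr : (index r R' < size R')%N by rewrite index_mem.
  have := congr1 (fun B : 'rV_(size R') => B 0 (Ordinal lr)) uA; rewrite !mxE sigma_p => E0.
  by rewrite -[RHS]E0; apply: eq_bigr => a _; rewrite mxE /= nth_index.
have sigmaN r : r \notin roots -> sigma r p = 0.
  move=> rN; apply: big1 => m /eqP Em; apply/eqP; rewrite mcoeff_eq0; apply/negP => mp.
  by move: rN; rewrite -Em comp_roots // (dhomog_mf hp mp).
have sigma0 : sigma r0 p = 0.
  have := toric_coef_sum hp Ip lep.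
  rewrite (bigID (fun m : 'X_{1..4 < k} => comp m == r0)) /= -/(sigma r0 p).
  rewrite (partition_big (fun m : 'X_{1..4 < k} => inord (comp m) : 'I_4) xpredT) //=.
  rewrite [X in _ + X]big1 ?addr0 // => r _.
  have [Er|ne] := eqVneq (r : nat) r0.
    rewrite big_pred0 // => m; rewrite -(inj_eq val_inj) /= inordK ?rep_ltn //.
    by rewrite -Er andNb.
  rewrite (eq_bigl (fun m : 'X_{1..4 < k} => comp m == r)) => [|m].
    have [rR|] := boolP ((r : nat) \in roots); last exact: sigmaN.
    by apply: sigmaR; move: rR; rewrite ER inE (negPf ne).
  rewrite -(inj_eq val_inj) /= inordK ?rep_ltn //.
  by case: (eqVneq (comp m) r) => [->|]; rewrite ?andbF // ne.
have mp : max_toric n p.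
  apply: (max_toric_comp lep hp) => r; rewrite -/(sigma r p).
  have [rR|] := boolP (r \in roots); last exact: sigmaN.
  by move: rR; rewrite ER inE => /orP [/eqP->//|]; apply: sigmaR.
have /rV0Pn [a ua] : u != 0 by [].
pose c (t : 'I_(size s)) := \sum_(b : 'I_#|J| | enum_val b == t) u 0 b.
have cE b : c (enum_val b) = u 0 b.
  by rewrite /c (big_pred1 b) // => b'; rewrite (inj_eq enum_val_inj).
apply: (minimal_homog_free (d := d) (c := c) (t0 := enum_val a) n_gt0 min_s).
- move=> t; apply: contraR => tJ; rewrite /c big_pred0 // => b; apply: contraNF tJ => /eqP <-.
  exact: hJ.
- by rewrite cE.
suff -> : \sum_t c t *: s`_t = p by [].
rewrite /c /p [RHS](partition_big (fun b => enum_val b) xpredT) //=.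
by apply: eq_bigr => t _; rewrite scaler_suml; apply: eq_bigr => b /eqP <-.
Qed.

End Components.

(** * The graph of a degree *)

Section Degrees.
Local Open Scope Z_scope.
Context (m : Z -> Prop) (f g i j k l : Z) (h : as3 m f g i j k l).

Definition gen4 a := nth 0 [:: i; j; k; l] a.

Definition state x : nat :=
  if `[< m x >] then 1%N else if `[< x = f \/ x = g >] then 2%N else 0%N.

Definition states d :=
  [seq state (d - gen4 p.1 - gen4 p.2) | p <- [:: (0, 1); (0, 2); (0, 3); (1, 2); (1, 3); (2, 3)]%N].

Definition vertices d : seq bool := [seq `[< m (d - gen4 a) >] | a <- iota 0 4].

Lemma states012 d : {subset states d <= [:: 0; 1; 2]%N}.
Proof. by move=> x /mapP [p _ ->]; rewrite /state; case: ifP => // _; case: ifP. Qed.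

Lemma state_dual x : state (f + g - x) = nth 0%N [:: 1; 0; 2]%N (state x).
Proof.
have [_ nf ng] := as_fg h; rewrite /state.
case: (asboolP (m (f + g - x))) => [mFx|nmFx].
  case: asboolP => [/(as_gap h)//|_]; case: asboolP => // -[E|E].
    by case: ng; rewrite (_ : g = f + g - x); [|lia].
  by case: nf; rewrite (_ : f = f + g - x); [|lia].
case: asboolP => [E|nE].
  have E' : x = f \/ x = g by lia.
  rewrite (asboolT E') asboolF //; by case: E' => ->.
case: asboolP => // nmx; case: nE; have := as_dual h nmFx.
rewrite (_ : f + g - (f + g - x) = x); last by lia.
by case; [move/nmx|left|right].
Qed.

Lemma states_dual d : states (f + g + i + j + k + l - d) = dual_state (states d).
Proof.
rewrite /dual_state /states /= /rev /= -!state_dual.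
by do 6![congr cons; first by congr state; rewrite /gen4 /=; lia].
Qed.

Lemma adj_states a b d : (a < 4)%N -> (b < 4)%N -> a != b ->
  adj (joined (states d)) a b = (0 < state (d - gen4 a - gen4 b))%N.
Proof.
have C x y : d - x - y = d - y - x by lia.
by case: a => [|[|[|[|a]]]] //; case: b => [|[|[|[|b]]]] // _ _ _; rewrite /adj /= /gen4 //= C.
Qed.

Lemma adj_edges a b d : (a < 4)%N -> (b < 4)%N -> a != b ->
  adj (is_state 1 (states d)) a b = `[< m (d - gen4 a - gen4 b) >].
Proof.
have C x y : d - x - y = d - y - x by lia.
have E x : (state x == 1)%N = `[< m x >] by rewrite /state; case: asboolP => // _; case: ifP.
by case: a => [|[|[|[|a]]]] //; case: b => [|[|[|[|b]]]] // _ _ _; rewrite /adj /= /gen4 //= E // C.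
Qed.

Lemma adj_loop (s : seq bool) a : size s = 6%N -> (a < 4)%N -> adj s a a = false.
Proof. by case: a => [|[|[|[|a]]]] // sz _; rewrite /adj /= nth_default // sz. Qed.

Lemma vertices_nth a d : (a < 4)%N -> nth false (vertices d) a = `[< m (d - gen4 a) >].
Proof. by case: a => [|[|[|[|a]]]]. Qed.

Lemma gen4_m a : (a < 4)%N -> m (gen4 a).
Proof. by have [? ? ? ?] := as_gens h; case: a => [|[|[|[|a]]]]. Qed.

Lemma gen4_gt0 a : (a < 4)%N -> 0 < gen4 a.
Proof. by have [? ? ? ?] := as_gt0 h; case: a => [|[|[|[|a]]]]. Qed.

Lemma state_gt0 x : (0 < state x)%N -> [\/ m x, x = f | x = g].
Proof.
rewrite /state; case: asboolP => [mx _|_]; first by constructor 1.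
by case: asboolP => // -[->|->] _; [constructor 2|constructor 3].
Qed.

(** Adding [gen4 b] back to an edge or a label gives an element of H, since [f] and [g] are
    pseudo-Frobenius. *)
Lemma supported_states d : supported (vertices d) (states d).
Proof.
apply/allP => a; rewrite mem_iota => a4; apply/allP => b; rewrite mem_iota => b4.
apply/implyP; have [->|ab] := eqVneq a b; first by rewrite adj_loop.
rewrite adj_states // vertices_nth // => /state_gt0 mab; apply/asboolP.
have mb := gen4_m b4; have b0 := gen4_gt0 b4.
rewrite (_ : d - gen4 a = d - gen4 a - gen4 b + gen4 b); last by lia.
case: mab => [mab|->|->]; [exact: (asD h)| |].
  by apply: (as_pf h) => //; lia.
by apply: (as_pg h) => //; lia.
Qed.

Lemma cut_dual d T a b : cut (vertices d) (states d) T -> (a < 4)%N -> (b < 4)%N ->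
  nth false T a -> nth false T b = false -> m (f + g + gen4 a + gen4 b - d).
Proof.
case/and3P => _ _ /allP /(_ a); rewrite mem_iota => H a4 b4 Ta Tb.
have /allP /(_ b) := H a4; rewrite mem_iota => /(_ b4); rewrite Ta Tb /=.
rewrite adj_states //; last by apply: contraTneq Ta => ->; rewrite Tb.
rewrite /state; case: asboolP => // nm; case: asboolP => // nfg _.
have := as_dual h nm; rewrite (_ : f + g - _ = f + g + gen4 a + gen4 b - d); last by lia.
by case=> // E; case: nfg; [left|right].
Qed.

Lemma cut_vertex d T : cut (vertices d) (states d) T ->
  (exists a, [/\ (a < 4)%N, nth false T a & m (d - gen4 a)]) /\
  (exists b, [/\ (b < 4)%N, nth false T b = false & m (d - gen4 b)]).
Proof.
case/and3P => /hasP [a]; rewrite mem_iota => a4 /andP [Va Ta].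
move=> /hasP [b]; rewrite mem_iota => b4 /andP [Vb /negbTE Tb] _.
rewrite !vertices_nth // in Va Vb; move/asboolP: Va => Va; move/asboolP: Vb => Vb.
by split; [exists a|exists b].
Qed.

(** A single vertex on one side is excluded by [as3_isolated]. Two against two gives equal sums by
    [as3_square], and the order of the generators leaves only [i + l = j + k]. *)
Lemma cut_states d T : i < j -> j < k -> k < l -> size T = 4%N -> cut (vertices d) (states d) T ->
  ((T == cut0) || (T == map negb cut0)) /\ (T = cut0 -> d = i + l /\ i + l = j + k).
Proof.
move=> ij jk kl sT cT; have [[a [a4 Ta ma]] [b [b4 Tb mb]]] := cut_vertex cT.
have D x y : (x < 4)%N -> (y < 4)%N -> nth false T x != nth false T y ->
    m (f + g + gen4 x + gen4 y - d).
  move=> x4 y4; case Tx: (nth false T x); case Ty: (nth false T y) => // _.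
    exact: (cut_dual cT).
  by rewrite (_ : _ - d = f + g + gen4 y + gen4 x - d); [apply: (cut_dual cT)|lia].
have iso p q r s : as3 m f g p q r s -> m (d - s) -> [\/ m (d - p), m (d - q) | m (d - r)] ->
    m (f + g + p + s - d) -> m (f + g + q + s - d) -> m (f + g + r + s - d) -> False.
  move=> hs ms [] mx Dp Dq Dr.
  - exact: (as3_isolated hs ms Dp Dq Dr mx).
  - exact: (as3_isolated (as3_swap hs) ms Dq Dp Dr mx).
  - exact: (as3_isolated (as3_rot3 (as3_rot3 hs)) ms Dr Dp Dq mx).
have hikjl := as3_swap (as3_rot3 (as3_rot3 h)).
have hiljk := as3_swap (as3_rot3 (as3_rot3 (as3_swap34 h))).
have D01 := D 0%N 1%N isT isT; have D02 := D 0%N 2%N isT isT; have D03 := D 0%N 3%N isT isT.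
have D12 := D 1%N 2%N isT isT; have D13 := D 1%N 3%N isT isT; have D23 := D 2%N 3%N isT isT.
have D10 := D 1%N 0%N isT isT; have D20 := D 2%N 0%N isT isT; have D30 := D 3%N 0%N isT isT.
have D21 := D 2%N 1%N isT isT; have D31 := D 3%N 1%N isT isT; have D32 := D 3%N 2%N isT isT.
clear D cT.
case: T sT Ta Tb D01 D02 D03 D12 D13 D23 D10 D20 D30 D21 D31 D32 => [|t0 [|t1 [|t2 [|t3 [|]]]]] // _.
rewrite /gen4 /= => Ta Tb D01 D02 D03 D12 D13 D23 D10 D20 D30 D21 D31 D32.
move: a4 Ta ma b4 Tb mb; rewrite /gen4.
(* All choices of [T] with a vertex of the graph on each side; afterwards only the duals of pairs
   crossing the cut are kept. *)
case: t0 D01 D02 D03 D10 D20 D30 => D01 D02 D03 D10 D20 D30;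
case: t1 D01 D12 D13 D10 D21 D31 => D01 D12 D13 D10 D21 D31;
case: t2 D02 D12 D23 D20 D21 D32 => D02 D12 D23 D20 D21 D32;
case: t3 D03 D13 D23 D30 D31 D32 => D03 D13 D23 D30 D31 D32;
case: a => [|[|[|[|a]]]] //= _ _ ma; case: b => [|[|[|[|b]]]] //= _ _ mb.
all: repeat match goal with H : is_true _ -> m _ |- _ => first [specialize (H isT) | clear H] end.
all: try by exfalso; first [
    apply: (iso i j k l) => //; by [constructor 1|constructor 2|constructor 3]
  | apply: (iso i j l k (as3_swap34 h)) => //; by [constructor 1|constructor 2|constructor 3]
  | apply: (iso k l i j (as3_half h)) => //; by [constructor 1|constructor 2|constructor 3]
  | apply: (iso j k l i (as3_rot h)) => //; by [constructor 1|constructor 2|constructor 3] ].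
all: try by exfalso; have [] : d = i + j /\ d = k + l; [apply: (as3_square h) => //; tauto|lia].
all: try by exfalso; have [] : d = i + k /\ d = j + l; [apply: (as3_square hikjl) => //; tauto|lia].
all: try by have [] : d = i + l /\ d = j + k; [apply: (as3_square hiljk) => //; tauto|split=> //; move=> *; lia].
Qed.

Lemma ncomp_states d : i < j -> j < k -> k < l -> (ncomp (vertices d) (is_state 1 (states d)) <=
  (gain (states d) + cut (vertices d) (states d) cut0).+1)%N.
Proof.
move=> ij jk kl; apply: ncomp_le_gain => //; [exact: states012|exact: supported_states|].
by move=> T sT cT; case: (cut_states ij jk kl sT cT).
Qed.

(** Above [f + g] every integer lies in H, so all six pairs are edges. *)
Lemma ncomp_large d : 0 <= f -> 0 <= g -> f + g + i + j + k + l < d ->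
  ncomp (vertices d) (is_state 1 (states d)) = 1%N.
Proof.
move=> f0 g0 dB; have [i0 j0 k0 l0] := as_gt0 h.
have big x : f + g < x -> m x.
  move=> xF; apply: contrapT => nx; case: (as_dual h nx) => [/(as_ge0 h) ?|?|?]; lia.
have Es a b : (a < b < 4)%N -> state (d - gen4 a - gen4 b) = 1%N.
  case/andP => ab b4; rewrite /state asboolT //; apply: big.
  by case: b ab b4 => [|[|[|[|b]]]] //; case: a => [|[|[|[|a]]]] // _ _; rewrite /gen4 /=; lia.
have Ev a : (a < 4)%N -> `[< m (d - gen4 a) >].
  move=> a4; apply/asboolP/big.
  by case: a a4 => [|[|[|[|a]]]] // _; rewrite /gen4 /=; lia.
by rewrite /vertices /states /= !Es // !Ev.
Qed.

Lemma sum_label x B : (\sum_(d < B) (Z.of_nat d =? x)%ZZ <= 1)%N.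
Proof.
have [d0 /Z.eqb_spec E0|none] := pickP (fun d : 'I_B => Z.of_nat d =? x)%ZZ; last first.
  by rewrite big1 // => d _; rewrite none.
rewrite (bigD1 d0) //= big1 ?addn0 ?leq_b1 // => d ne.
by case: Z.eqb_spec => // E; case/eqP: ne; apply/val_inj/Nat2Z.inj; rewrite E.
Qed.

(** Each of the six pairs carries each of the labels [f], [g] in at most one degree. *)
Lemma sum_labels B : (\sum_(d < B) count_mem 2%N (states (Z.of_nat d)) <= 12)%N.
Proof.
pose L := [:: (0, 1); (0, 2); (0, 3); (1, 2); (1, 3); (2, 3)]%N.
have le d : (count_mem 2%N (states d) <= \sum_(p <- L)
    ((d =? f + gen4 p.1 + gen4 p.2)%ZZ + (d =? g + gen4 p.1 + gen4 p.2)%ZZ))%N.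
  rewrite count_map -sum1_count big_mkcond; apply: leq_sum => p _ /=.
  rewrite /state; case: asboolP => // _; case: asboolP => // -[E|E].
    by rewrite (_ : (d =? f + _ + _)%ZZ = true) //; apply/Z.eqb_eq; lia.
  by rewrite (_ : (d =? g + _ + _)%ZZ = true) ?addn1 //; apply/Z.eqb_eq; lia.
apply: leq_trans; first by apply: leq_sum => d _; apply: le.
rewrite exchange_big; apply: (@leq_trans (\sum_(p <- L) 2)%N); last by rewrite /L !big_cons big_nil.
apply: leq_sum => p _; rewrite big_split /=.
by apply: (@leq_add _ _ 1 1); apply: sum_label.
Qed.

Lemma sum_gain B : Z.of_nat B = f + g + i + j + k + l + 1 ->
  (\sum_(d < B) gain (states (Z.of_nat d)) <= 6)%N.
Proof.
move=> EB; rewrite -(leq_pmul2l (isT : (0 < 2)%N)) mul2n -addnn.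
(* By the choice of [B], reversing the range is the passage to the dual degree, so twice the sum
   counts labels. *)
rewrite {2}(reindex_inj rev_ord_inj) /= -big_split /=.
apply: leq_trans (sum_labels B); apply: leq_sum => d _.
rewrite -gain_dual //; last exact: states012.
rewrite -states_dual (_ : Z.of_nat (B - d.+1) = f + g + i + j + k + l - Z.of_nat d) //.
have lt := ltn_ord d; rewrite -minusE Nat2Z.inj_sub; [lia|exact/leP].
Qed.
End Degrees.

(** * Pseudo-Frobenius numbers *)

From mathcomp Require Import zify.

Section Gaps.
Local Open Scope classical_set_scope.
Local Open Scope nat_scope.
Context (H : set nat) (nsH : numerical_semigroup H).

Let F := frobenius H.

Lemma mem_gaps x : (x \in gaps H) = `[< ~ H x >].
Proof. by rewrite /gaps in_fset_set; [apply/idP/asboolP; rewrite inE|exact: ns_finite nsH]. Qed.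

Lemma gap_le_frobenius x : ~ H x -> x <= F.
Proof.
move=> nHx; have xs : x \in enum_fset (gaps H).
  by rewrite -[_ \in _]/(x \in gaps H) mem_gaps; apply/asboolP.
exact: (@leq_bigmax_seq nat (enum_fset (gaps H)) xpredT id x xs isT).
Qed.

Lemma frobenius_gap : ~ H F.
Proof.
have [x nHx] : exists x, ~ H x.
  by apply/not_existsP => allH; apply: (ns_proper nsH); apply/seteqP; split=> // x _; apply: contrapT.
have big (s : seq nat) : \max_(y <- s) y = 0 \/ \max_(y <- s) y \in s.
  elim: s => [|y s IH]; first by left; rewrite big_nil.
  rewrite big_cons inE; case: leqP => _; last by right; rewrite eqxx.
  by case: IH => [->|->]; [left|right; rewrite orbT].
case: (big (gaps H)) => [F0|]; last by rewrite mem_gaps => /asboolP.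
by move: (gap_le_frobenius nHx); rewrite /F /frobenius F0 leqn0 => /eqP <-.
Qed.

Lemma large_in x : F < x -> H x.
Proof. by move=> lt; apply: contrapT => /gap_le_frobenius; rewrite leqNgt lt. Qed.

Lemma card_gaps : #|` gaps H| = \sum_(x < F.+1) `[< ~ H x >].
Proof.
rewrite -(big_mkord xpredT (fun x => `[< ~ H x >] : nat)) -big_mkcond sum1_count -size_filter.
apply/perm_size/uniq_perm; rewrite ?fset_uniq ?filter_uniq ?iota_uniq // => x.
rewrite mem_filter mem_index_iota ltnS /= mem_gaps.
by case: asboolP => //= /gap_le_frobenius ->.
Qed.

Lemma gap_sub_mem x : x <= F -> H (F - x) -> ~ H x.
Proof. by move=> le HFx Hx; apply: frobenius_gap; rewrite -(subnK le); apply: (ns_add nsH). Qed.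

Definition symmetric_gaps := [seq x <- iota 0 F.+1 | `[< ~ H x /\ ~ H (F - x) >]].

(** Reflection in [F] maps the elements of H up to [F] injectively to gaps and misses exactly
    [symmetric_gaps]. Hence twice the number of gaps is [F + 1] plus the number of symmetric
    gaps. *)
Lemma size_symmetric_gaps t : 2 * #|` gaps H| = F + t -> (size symmetric_gaps).+1 = t.
Proof.
move=> as_t; pose P x := `[< H x >].
have NP x : `[< ~ H x >] = ~~ P x by rewrite /P asbool_neg.
have EL : size symmetric_gaps = \sum_(x < F.+1) (~~ P x && ~~ P (F - x)).
  rewrite size_filter -sum1_count -/(index_iota 0 F.+1) big_mkcond big_mkord.
  by apply: eq_bigr => x _; rewrite /= asbool_and !NP; case: (_ && _).
have EP : \sum_(x < F.+1) (~~ P x && P (F - x)) = \sum_(x < F.+1) P x.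
  rewrite [RHS](reindex_inj rev_ord_inj) /=; apply: eq_bigr => x _; rewrite subSS.
  case Px: (P (F - x)); last by rewrite andbF.
  rewrite andbT; apply/eqP; rewrite eqb1; apply/asboolPn; apply: gap_sub_mem; last exact/asboolP.
  by rewrite -ltnS.
have E1 : \sum_(x < F.+1) P x + \sum_(x < F.+1) ~~ P x = F.+1.
  rewrite -big_split /= -[RHS]card_ord -sum1_card; apply: eq_bigr => x _.
  by case: (P x).
have E2 : size symmetric_gaps + \sum_(x < F.+1) P x = \sum_(x < F.+1) ~~ P x.
  rewrite EL -EP -big_split /=; apply: eq_bigr => x _; by case: (P x); case: (P (F - x)).
move: as_t; rewrite card_gaps; under eq_bigr do rewrite NP.
move: E1 E2 {EL EP}; move: (size _) (\sum_(x < _) nat_of_bool (P x)) (\sum_(x < _) nat_of_bool (~~ P x)) => a b c.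
by rewrite -/F; lia.
Qed.

End Gaps.

(** * Minimal generating systems and pseudo-Frobenius numbers *)

Section Generators.
Local Open Scope classical_set_scope.
Local Open Scope nat_scope.
Context (H : set nat) (e : nat) (n : 'I_e -> nat) (nsH : numerical_semigroup H).
Context (gen : submonoid_gen n [set: 'I_e]%SET = H).

Lemma mem_wdeg x : H x <-> exists m : 'X_{1..e}, wdeg n m = x.
Proof.
rewrite -gen; split=> [[a ->]|[m <-]].
  exists [multinom a i | i < e]; rewrite /wdeg; apply: eq_big => [i|i _]; first by rewrite inE.
  by rewrite mnmE.
by exists m; rewrite /wdeg; apply: eq_bigl => i; rewrite inE.
Qed.

Lemma wdeg1 i : wdeg n U_(i)%MM = n i.
Proof.
rewrite /wdeg (bigD1 i) //= mnm1E eqxx mul1n big1 ?addn0 // => j /negPf.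
by rewrite mnm1E eq_sym => ->.
Qed.

Lemma wdeg_sub1 (m : 'X_{1..e}) i : 0 < m i -> wdeg n m = wdeg n (m - U_(i))%MM + n i.
Proof.
move=> mi; have Em : m = (m - U_(i) + U_(i))%MM by rewrite submK // lep1mP -lt0n.
by rewrite {1}Em wdegD wdeg1.
Qed.

Lemma gen_mem i : H (n i).
Proof. by apply/mem_wdeg; exists U_(i)%MM; apply: wdeg1. Qed.

Lemma mem_split x : H x -> x = 0 \/ exists i, n i <= x /\ H (x - n i).
Proof.
move=> /mem_wdeg [m <-]; have [i mi|m0] := pickP (fun i => 0 < m i).
  right; exists i; rewrite (wdeg_sub1 mi) leq_addl addnK; split=> //.
  by apply/mem_wdeg; exists (m - U_(i))%MM.
by left; rewrite /wdeg big1 // => i _; move/negbT: (m0 i); rewrite -eqn0Ngt => /eqP->.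
Qed.

Context (mingen : forall A : {set 'I_e}, submonoid_gen n A = H -> A = [set: 'I_e]%SET).

Lemma minimal_generator (i : 'I_e) (b : 'I_e -> nat) : n i <> \sum_(j | j != i) b j * n j.
Proof.
move=> Ei; have /setP/(_ i) : [set~ i]%SET = [set: 'I_e]%SET.
  apply: mingen; rewrite -gen; apply/seteqP; split=> x [a ->].
    exists (fun j => if j == i then 0 else a j).
    rewrite [RHS](bigD1 i) ?inE //= eqxx mul0n add0n; apply: eq_big => [j|j]; rewrite !inE //.
    by move=> /negPf ->.
  exists (fun j => a j + a i * b j); rewrite (bigD1 i) ?inE //= {1}Ei big_distrr /=.
  rewrite [X in _ + X](eq_bigl (fun j => j != i)) => [|j]; last by rewrite !inE.
  rewrite -big_split /=; apply: eq_big => [j|j _]; first by rewrite !inE.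
  by rewrite mulnA -mulnDl addnC.
by rewrite !inE eqxx.
Qed.

Lemma generator_gt0 i : 0 < n i.
Proof.
rewrite lt0n; apply/eqP => ni; apply: (@minimal_generator i (fun=> 0)).
by rewrite ni big1 // => j _; rewrite mul0n.
Qed.

Lemma generator_incomparable i j h : i != j -> H h -> n i <> n j + h.
Proof.
move=> ij /mem_wdeg [m <-] E; have [mi|] := ltnP 0 (m i).
  by move: E; rewrite (wdeg_sub1 mi); have := generator_gt0 j; lia.
rewrite leqn0 => /eqP mi; apply: (@minimal_generator i (fun k => m k + (k == j))).
rewrite {1}E /wdeg (bigD1 i) //= mi mul0n add0n [RHS](eq_bigr (fun k => m k * n k + (k == j) * n k)).
  rewrite big_split /= addnC; congr (_ + _); rewrite (bigD1 j) //=; last by rewrite eq_sym.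
  by rewrite eqxx mul1n big1 ?addn0 // => k /andP [_ /negPf ->].
by move=> k _; rewrite mulnDl.
Qed.

Lemma pseudo_frobeniusD (x : int) h : pseudo_frobenius n H x -> H h -> h != 0 -> zmem H (x + Posz h)%R.
Proof.
move=> [_ PFx] Hh h0; case: (mem_split Hh) => [E|[i [le Hi]]]; first by rewrite E in h0.
have [c Hc Ec] := PFx i; exists (c + (h - n i)); first exact: (ns_add nsH).
rewrite PoszD Ec -addrA -PoszD subnKC //.
Qed.

(** Every pseudo-Frobenius number other than [F] is a symmetric gap. Almost symmetry leaves two
    symmetric gaps and type 3 at least two such numbers, so the sets agree; reflection in [F] then
    gives [f + g = F]. *)
Lemma pseudo_frobenius_pair : almost_symmetric n H -> ns_type n H = 3 ->
  exists f g, [/\ f + g = frobenius H, f <> g, ~ H f & ~ H g] /\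
    [/\ forall x, H x -> x != 0 -> H (f + x), forall x, H x -> x != 0 -> H (g + x) &
        forall x, x <= frobenius H -> ~ H x -> [\/ H (frobenius H - x), x = f | x = g]].
Proof.
move=> asH t3; set F := frobenius H.
have := size_symmetric_gaps nsH asH; rewrite t3 => -[].
set L := symmetric_gaps H => sL.
have fin : finite_set (pseudo_frobenius n H).
  by move: t3; rewrite /ns_type /fset_set; case: pselect => // _; rewrite cardfs0.
set X := enum_fset (fset_set (pseudo_frobenius n H)).
have memX x : x \in X -> pseudo_frobenius n H x.
  by rewrite /X -[_ \in _]/(x \in fset_set _) in_fset_set // inE.
have uL : uniq [seq Posz x | x <- L].
  by rewrite map_inj_uniq ?filter_uniq ?iota_uniq // => a b [].
have sub : {subset rem (Posz F) X <= [seq Posz x | x <- L]}.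
  move=> x; rewrite mem_rem_uniq ?fset_uniq // inE => /andP [xF /memX PFx].
  have nF : ~ zmem H (Posz F) by case=> y Hy [E]; apply: (frobenius_gap nsH); rewrite -/F -E.
  (* A negative number [-(x + 1)] would reach [F] by adding [F + x + 1], which lies in H. *)
  case: x xF PFx => [x|x] xF PFx; last first.
    have := pseudo_frobeniusD (h := F + x.+1) PFx; rewrite addnS /=.
    move=> /(_ (large_in nsH _) isT); rewrite ltnS leq_addr => /(_ isT) HF; case: nF.
    by move: HF; rewrite (_ : (_ + _)%R = Posz F) //; lia.
  have nHx : ~ H x by case: PFx => nz _ Hx; apply: nz; exists x.
  have le := gap_le_frobenius nsH nHx; apply: map_f; rewrite mem_filter mem_iota leq0n add0n ltnS le !andbT.
  apply/asboolP; split=> // HFx; apply: nF.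
  have := pseudo_frobeniusD PFx HFx; rewrite -PoszD subnKC //; apply.
  by rewrite subn_eq0 -ltnNge ltn_neqAle le andbT; apply: contra xF => /eqP ->.
have sX : 2 <= size (rem (Posz F) X).
  have szX : size X = 3 by exact: t3.
  have [FX|FX] := boolP (Posz F \in X); last by rewrite rem_id // szX.
  by rewrite size_rem // szX.
have [_ eqXL] := uniq_min_size (rem_uniq _ (fset_uniq _)) sub (leq_trans (eq_leq (size_map _ _)) (leq_trans (eq_leq sL) sX)).
have PFL y : y \in L -> pseudo_frobenius n H (Posz y).
  by move=> yL; apply: memX; apply: (mem_rem (x := Posz F)); rewrite eqXL map_f.
have addL y : y \in L -> forall x, H x -> x != 0 -> H (y + x).
  move=> /PFL PFy x Hx x0; have [c Hc] := pseudo_frobeniusD PFy Hx x0.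
  by rewrite -PoszD => -[<-].
have memL y : (y \in L) <-> [/\ y <= F, ~ H y & ~ H (F - y)].
  rewrite mem_filter mem_iota ltnS /=; split.
    by case/andP => /asboolP [? ?].
  by case=> -> ? ?; rewrite andbT; apply/asboolP.
have uniqL : uniq L by rewrite filter_uniq ?iota_uniq.
clearbody L; case: L sL uniqL memL addL {uL sub eqXL PFL} => [|f [|g [|]]] //= _ fg memL addL.
move: fg; rewrite inE andbT => /eqP fg.
have [fF nf nFf] := proj1 (memL f) (mem_head _ _).
have gL : g \in [:: f; g] by rewrite !inE eqxx orbT.
have [gF ng nFg] := proj1 (memL g) gL.
have invL y : y <= F -> ~ H y -> ~ H (F - y) -> F - y \in [:: f; g].
  by move=> yF ny nFy; apply/memL; rewrite leq_subr subKn.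
exists f, g; split; split=> //.
- have := invL f fF nf nFf; have := invL g gF ng nFg; rewrite !inE.
  by move=> /orP [] /eqP ? /orP [] /eqP ?; lia.
- exact: addL (mem_head _ _).
- exact: addL gL.
- move=> x xF nx; have [HFx|nFx] := pselect (H (F - x)); first by constructor 1.
  have : x \in [:: f; g] by apply/memL.
  by rewrite !inE => /orP [] /eqP ->; [constructor 2|constructor 3].
Qed.

End Generators.

(** * The semigroup inside Z and its graphs *)

Section FourGenerators.
Local Open Scope classical_set_scope.
Local Open Scope nat_scope.

Definition zset (H : set nat) (x : Z) : Prop := (0 <= x)%ZZ /\ H (Z.to_nat x).

Lemma zset_nat (H : set nat) (x : nat) : zset H (Z.of_nat x) <-> H x.
Proof. by rewrite /zset Nat2Z.id; split=> [[]//|Hx]; split=> //; exact: Zle_0_nat. Qed.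

Lemma zset_sub (H : set nat) (x y : nat) : zset H (Z.of_nat x - Z.of_nat y) <-> y <= x /\ H (x - y).
Proof.
split=> [[le]|[le Hxy]].
  have yx : y <= x by lia.
  by rewrite (_ : Z.to_nat _ = x - y); last by lia.
by rewrite (_ : (_ - _)%ZZ = Z.of_nat (x - y)); [apply/zset_nat|lia].
Qed.

Lemma gens4E n1 n2 n3 n4 i : gens4 n1 n2 n3 n4 i = nth 0 [:: n1; n2; n3; n4] i.
Proof. by rewrite /gens4 (tnth_nth 0). Qed.

Lemma gen4_gens4 n1 n2 n3 n4 (i : 'I_4) :
  gen4 (Z.of_nat n1) (Z.of_nat n2) (Z.of_nat n3) (Z.of_nat n4) i =
  Z.of_nat (gens4 n1 n2 n3 n4 i).
Proof. by rewrite gens4E; case: i => [[|[|[|[|]]]]]. Qed.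

Lemma as3_semigroup (H : set nat) n1 n2 n3 n4 : let n := gens4 n1 n2 n3 n4 in
  numerical_semigroup H -> n1 < n2 -> n2 < n3 -> n3 < n4 -> minimally_generated n H ->
  almost_symmetric n H -> ns_type n H = 3 ->
  exists f g : nat, as3 (zset H) (Z.of_nat f) (Z.of_nat g)
    (Z.of_nat n1) (Z.of_nat n2) (Z.of_nat n3) (Z.of_nat n4).
Proof.
move=> n nsH n12 n23 n34 [gen min] asH t3.
have [f [g [[Efg fg nf ng] [pf pg dual]]]] := pseudo_frobenius_pair nsH gen asH t3.
have mem k (k4 : k < 4) : H (nth 0 [:: n1; n2; n3; n4] k).
  by have := gen_mem gen (Ordinal k4); rewrite /n gens4E.
have pos k (k4 : k < 4) : 0 < nth 0 [:: n1; n2; n3; n4] k.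
  by have := generator_gt0 gen min (Ordinal k4); rewrite /n gens4E.
have inc a b (a4 : a < 4) (b4 : b < 4) : a != b ->
    ~ zset H (Z.of_nat (nth 0 [:: n1; n2; n3; n4] a) - Z.of_nat (nth 0 [:: n1; n2; n3; n4] b)).
  move=> ab /zset_sub [le Hab].
  have ne : Ordinal a4 != Ordinal b4 by [].
  by apply: (generator_incomparable gen min ne Hab); rewrite /n !gens4E /= subnKC.
have p0 := pos 0 isT; have p1 := pos 1 isT; have p2 := pos 2 isT; have p3 := pos 3 isT.
rewrite /= in p0 p1 p2 p3.
exists f, g; split.
- by apply/(zset_nat H 0); exact: ns_zero nsH.
- move=> x y [x0 Hx] [y0 Hy]; split; first lia.
  by rewrite Z2Nat.inj_add //; apply: (ns_add nsH).
- by move=> x [].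
- split; apply/zset_nat; [exact: (mem 0)|exact: (mem 1)|exact: (mem 2)|exact: (mem 3)].
- by split; split; lia.
- by split; lia.
- move=> x [x0 Hx]; case: (mem_split gen Hx) => [E|[i [le Hi]]]; first by constructor 1; left; lia.
  have Hi' : zset H (x - Z.of_nat (n i)).
    by rewrite -(Z2Nat.id x) //; apply/zset_sub.
  move: Hi'; rewrite /n gens4E; case: i {le Hi} => [[|[|[|[|]]]]] //= _ Hi'.
  + by constructor 1; right.
  + by constructor 2.
  + by constructor 3.
  + by constructor 4.
- by split; [apply: (inc 0 1)|apply: (inc 0 2)|apply: (inc 0 3)].
- by split; [apply: (inc 1 0)|apply: (inc 1 2)|apply: (inc 1 3)].
- by split; [apply: (inc 2 0)|apply: (inc 2 1)|apply: (inc 2 3)].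
- by split; [apply: (inc 3 0)|apply: (inc 3 1)|apply: (inc 3 2)].
- by split; [lia|rewrite zset_nat|rewrite zset_nat].
- move=> x [x0 Hx] nx; split; first lia.
  by rewrite Z2Nat.inj_add ?Nat2Z.id; [apply: pf => //; lia|lia|].
- move=> x [x0 Hx] nx; split; first lia.
  by rewrite Z2Nat.inj_add ?Nat2Z.id; [apply: pg => //; lia|lia|].
- move=> x [x0 Hx] [y0 Hy]; apply: (frobenius_gap nsH); rewrite -Efg.
  rewrite (_ : f + g = Z.to_nat x + Z.to_nat (Z.of_nat f + Z.of_nat g - x)); last by lia.
  exact: (ns_add nsH).
- move=> x nx; case: (Z.le_gt_cases 0 x) => x0; last first.
    (* For negative [x], [f + g - x] exceeds the Frobenius number. *)
    constructor 1; split; first lia.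
    by apply: (large_in nsH); rewrite -Efg; lia.
  have nHx : ~ H (Z.to_nat x) by move=> Hx; apply: nx.
  have le := gap_le_frobenius nsH nHx.
  rewrite -Efg in le dual; case: (dual _ le nHx) => [HF|E|E]; [constructor 1|constructor 2|constructor 3];
    try by rewrite -E Z2Nat.id.
  rewrite (_ : (_ - x)%ZZ = (Z.of_nat (f + g) - Z.of_nat (Z.to_nat x))%ZZ); last by lia.
  exact/zset_sub.
Qed.

(** Vertices and edges are the variables and the pairs of variables that divide some monomial of
    weight [d], as [count_generators] requires. *)
Lemma count_states (K : fieldType) (s : seq {mpoly K[4]}) (H : set nat) n1 n2 n3 n4 (f g : Z) d :
  let n := gens4 n1 n2 n3 n4 in minimally_generated n H ->
  minimal_homog_generators n (toric_ideal K n) s ->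
  as3 (zset H) f g (Z.of_nat n1) (Z.of_nat n2) (Z.of_nat n3) (Z.of_nat n4) -> 0 < d ->
  count (fun p => p \is d.-homog for (wdeg n)) s <= (ncomp
    (vertices (zset H) (Z.of_nat n1) (Z.of_nat n2) (Z.of_nat n3) (Z.of_nat n4) (Z.of_nat d))
    (is_state 1 (states (zset H) f g
       (Z.of_nat n1) (Z.of_nat n2) (Z.of_nat n3) (Z.of_nat n4) (Z.of_nat d)))).-1.
Proof.
move=> n [gen min] min_s h d0.
have mem2 (m : 'X_{1..4}) (i j : 'I_4) : i != j -> 0 < m i -> 0 < m j ->
    exists m', wdeg n m = wdeg n m' + n i + n j.
  move=> ij mi mj; exists (m - U_(i) - U_(j))%MM.
  rewrite (wdeg_sub1 n mi) (@wdeg_sub1 _ n (m - U_(i))%MM j); first by lia.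
  by rewrite mnmBE mnm1E (negPf ij) subn0.
have adjZ (i j : 'I_4) : i != j ->
    adj (is_state 1 (states (zset H) f g (Z.of_nat n1) (Z.of_nat n2) (Z.of_nat n3) (Z.of_nat n4) (Z.of_nat d))) i j =
    `[< n i + n j <= d /\ H (d - (n i + n j)) >].
  move=> ij; rewrite adj_edges // !gen4_gens4; apply: asbool_equiv_eq.
  by rewrite -zset_sub Nat2Z.inj_add Z.sub_add_distr.
apply: (count_generators (generator_gt0 gen min) min_s d0) => //.
- move=> i; rewrite vertices_nth // gen4_gens4 => /asboolP/zset_sub [le /(mem_wdeg gen) [m Em]].
  exists (m + U_(i))%MM; rewrite wdegD wdeg1 Em subnK //; split=> //.
  by rewrite mnmDE mnm1E eqxx addn1.
- move=> m i Em mi; rewrite vertices_nth // gen4_gens4; apply/asboolP/zset_sub.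
  rewrite -Em (wdeg_sub1 n mi) leq_addl addnK; split=> //.
  by apply/(mem_wdeg gen); exists (m - U_(i))%MM.
- move=> i j; have [->|ij] := eqVneq i j; first by rewrite adj_loop.
  rewrite adjZ // => /asboolP [le /(mem_wdeg gen) [m Em]].
  exists (m + (U_(i) + U_(j)))%MM; rewrite !wdegD !wdeg1 Em subnK //; split=> //.
    by rewrite !mnmDE !mnm1E eqxx; lia.
  by rewrite !mnmDE !mnm1E eqxx; lia.
- move=> m i j ij Em mi mj; rewrite adjZ //; apply/asboolP.
  have [m' Em'] := mem2 _ _ _ ij mi mj; rewrite -Em Em' -addnA leq_addl addnK; split=> //.
  by apply/(mem_wdeg gen); exists m'.
Qed.

End FourGenerators.

(** * Summation over all degrees *)

Theorem theorem6p5 (K : fieldType) (H : set nat) (n1 n2 n3 n4 : nat) :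
  numerical_semigroup H ->
  n1 < n2 -> n2 < n3 -> n3 < n4 ->
  minimally_generated (gens4 n1 n2 n3 n4) H ->
  almost_symmetric (gens4 n1 n2 n3 n4) H ->
  ns_type (gens4 n1 n2 n3 n4) H = 3 ->
  forall s : seq {mpoly K[4]},
    minimal_homog_generators (gens4 n1 n2 n3 n4)
      (toric_ideal K (gens4 n1 n2 n3 n4)) s ->
    6 < size s ->
    size s = 7 /\ n1 + n4 = n2 + n3.
Proof.
move=> nsH n12 n23 n34 minH asH t3 s min_s s7.
have [f [g h]] := as3_semigroup nsH n12 n23 n34 minH asH t3.
have [gen min] := minH.
(* Graphs of degree [B] or more are connected, and reversing the range below [B] is duality. *)
pose B := f + g + n1 + n2 + n3 + n4 + 1.
pose V d := vertices (zset H) (Z.of_nat n1) (Z.of_nat n2) (Z.of_nat n3) (Z.of_nat n4) (Z.of_nat d).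
pose st d := states (zset H) (Z.of_nat f) (Z.of_nat g)
  (Z.of_nat n1) (Z.of_nat n2) (Z.of_nat n3) (Z.of_nat n4) (Z.of_nat d).
pose c d : nat := cut (V d) (st d) cut0.
pose N d := count (fun p => p \is d.-homog for (wdeg (gens4 n1 n2 n3 n4))) s.
have [Z12 Z23 Z34] : [/\ (Z.of_nat n1 < Z.of_nat n2)%ZZ, (Z.of_nat n2 < Z.of_nat n3)%ZZ &
  (Z.of_nat n3 < Z.of_nat n4)%ZZ] by split; lia.
(* The toric ideal has no nonzero element of degree 0. *)
have N0 d : N d <> 0 -> 0 < d.
  case: d => // N0; exfalso; apply: N0; apply/eqP; rewrite -leqn0 leqNgt -has_count.
  apply/hasPn => p /(nthP 0%R) [t lt <-]; apply/negP => hp.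
  have := minimal_homog_neq0 min_s (Ordinal lt).
  rewrite (toric_dhomog0 (generator_gt0 gen min) hp) ?eqxx //.
  exact: (minimal_homog_toric min_s (Ordinal lt)).
have Nle d : N d <= gain (st d) + c d.
  case: (posnP d) => [->|d0].
    by have := N0 0; case: (N 0) => // k /(_ (@PeanoNat.Nat.neq_succ_0 k)).
  apply: leq_trans (count_states minH min_s h d0) _.
  by rewrite -subn1 leq_subLR add1n; exact: (ncomp_states h _ Z12 Z23 Z34).
have NB d : B <= d -> N d = 0.
  move=> dB; have d0 : 0 < d by apply: leq_trans dB; rewrite /B addn1.
  have := count_states minH min_s h d0; rewrite (ncomp_large h); [|lia|lia|rewrite /B in dB; lia].
  by rewrite leqn0 => /eqP.
have size_s : size s <= \sum_(d < B) N d.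
  rewrite /N; under eq_bigr do rewrite -sum1_count (big_nth 0%R) big_mkord big_mkcond.
  rewrite exchange_big /= -[X in X <= _]card_ord -sum1_card; apply: leq_sum => t _.
  set d := (mmeasure (wdeg (gens4 n1 n2 n3 n4)) (s`_t)%R).-1.
  have hd : (s`_t)%R \is d.-homog for (wdeg (gens4 n1 n2 n3 n4)) := minimal_homog_dhomog min_s t.
  have dB : d < B.
    rewrite ltnNge; apply/negP => /NB /eqP; rewrite -leqn0 leqNgt -has_count => /negP; apply.
    by apply/hasP; exists (s`_t)%R; rewrite ?mem_nth.
  by rewrite (bigD1 (Ordinal dB)) //= hd.
have sum_st : \sum_(d < B) gain (st d) <= 6.
  by apply: (sum_gain h); lia.
have cE d : 0 < c d -> d = n1 + n4 /\ n1 + n4 = n2 + n3.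
  rewrite /c lt0b => cut_d; have [_ /(_ erefl)] := cut_states h Z12 Z23 Z34 (erefl : size cut0 = 4) cut_d.
  by lia.
(* The exceptional cut occurs only in degree [n1 + n4], so it adds at most 1. *)
have sumc : \sum_(d < B) c d <= 1.
  have [d cd|none] := pickP (fun d : 'I_B => 0 < c d); last first.
    by rewrite big1 // => d _; apply/eqP; move: (none d); rewrite lt0n => /negbFE.
  rewrite (bigD1 d) //= big1 ?addn0 ?leq_b1 // => d' ne; apply/eqP; rewrite -leqn0 leqNgt.
  apply/negP => cd'; case/eqP: ne; apply/val_inj.
  by rewrite /= (proj1 (cE _ cd)) (proj1 (cE _ cd')).
have : size s <= \sum_(d < B) gain (st d) + \sum_(d < B) c d.
  by apply: (leq_trans size_s); rewrite -big_split /=; apply: leq_sum => d _.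
(* The bound is 6 + 1; a seventh generator needs a degree with the exceptional cut, which gives the
   linear relation. *)
move=> le; split; first by lia.
have [d cd|none] := pickP (fun d : 'I_B => 0 < c d); first exact: (proj2 (cE d cd)).
have c0 : \sum_(d < B) c d = 0.
  by apply: big1 => d _; apply/eqP; move: (none d); rewrite lt0n => /negbFE.
by lia.
Qed.
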